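(* For any instance of the online add-on discount revenue management problem, the regret of the UCB-Add-On algorithm with input parameter $\varepsilon$ can be upper-bounded by $$\mathrm{Regret}(T)\le \mathcal O\left(NM\hat p\left(\frac1\lambda\cdot\sqrt{UT\log T}+\varepsilon\sqrt T\right)\right),$$ where $\hat p$ is the maximum price, $\lambda$ is the lowest possible probability that the total primary demand is non-zero, and $U:=\max\{|\Omega_c|,|\Omega_s|,|\Omega_a|\}$.
   Context: **Problem.** There are $N$ core products and $M$ supportive products, finite sets $\Omega_c,\Omega_s,\Omega_a$ of nonnegative prices (for core products, supportive products and add-on discounts), an integer $S\ge 0$, and demand functions $\alpha_n:\Omega_c\to[0,1]$ ($n=1,\dots,N$), $\alpha_{N+m}:\Omega_s\to[0,1]$, $\beta_{N+m}:\Omega_s\to[0,1]$, $\beta'_{N+m}:\Omega_a\to[0,1]$ ($m=1,\dots,M$). A feasible policy $\Pi$ specifies $p_n\in\Omega_c$ for $n=1,\dots,N$ and $p_{N+m}\in\Omega_s$, $p'_{N+m}\in\Omega_a$, $I_{N+m}\in\{0,1\}$ for $m=1,\dots,M$, with $\sum_{m=1}^M I_{N+m}\le S$ and $p'_{N+m}<p_{N+m}$ for all $m=1,\dots,M$. Its one-period expected revenue is $$\mathcal R(\Pi)=\sum_{n=1}^N\alpha_n(p_n)p_n+\sum_{m=1}^M\alpha_{N+m}(p_{N+m})p_{N+m}+\Big[\sum_{n=1}^N\alpha_n(p_n)\Big]\sum_{m=1}^M\Big[I_{N+m}\beta'_{N+m}(p'_{N+m})p'_{N+m}+(1-I_{N+m})\beta_{N+m}(p_{N+m})p_{N+m}\Big].$$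 $\mathcal R^*$ is the maximum of $\mathcal R(\Pi)$ over feasible policies; $\hat p:=\max_{p\in\Omega_c\cup\Omega_s}p$. **Demand.** In each period under policy $\Pi$, the primary demand for core product $n$ is Bernoulli with mean $\alpha_n(p_n)$ and the primary demand for supportive product $m$ is Bernoulli with mean $\alpha_{N+m}(p_{N+m})$. A customer who has purchased one core product continues to purchase supportive product $m$ (add-on purchase) with probability $\beta'_{N+m}(p'_{N+m})$ if $I_{N+m}=1$ (discount price) and $\beta_{N+m}(p_{N+m})$ if $I_{N+m}=0$ (original price). Demand is independent across products. Purchases are observed; the demand functions are unknown to the retailer. **Discretized DP Algorithm** (input: the price sets, all values of the demand functions, and a positive integer $K$). Part 1. For each $m$ and each $\gamma\in\{0,\frac1K,\dots,\frac{NK}{K}\}$, compute $r_{N+m}(\gamma)=\max_{p\in\Omega_s}\{\alpha_{N+m}(p)p+\gamma\beta_{N+m}(p)p\}$ and $r'_{N+m}(\gamma)=\max_{p\in\Omega_s,\,p'\in\Omega_a,\,p'<p}\{\alpha_{N+m}(p)p+\gamma\beta'_{N+m}(p')p'\}$. For each $\gamma$, sort $r'_{N+m}(\gamma)-r_{N+m}(\gamma)$ in descending order; set $I_{N+m}(\gamma)=1$ if this difference is positive and among the first $S$ entries, else $I_{N+m}(\gamma)=0$. Set $\mathcal R_s(\gamma)=\sum_m\big[r_{N+m}(\gamma)+I_{N+m}(\gamma)(r'_{N+m}(\gamma)-r_{N+m}(\gamma))\big]$. Part 2. Let $\hat\alpha_n(p)$ be $\alpha_n(p)$ rounded to the nearest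 integer multiple of $1/K$. Solve by backward induction $V_{N+1}(\gamma)=\mathcal R_s(\gamma)$, $V_n(\gamma)=\max_{p_n\in\Omega_c}[\alpha_n(p_n)p_n+V_{n+1}(\gamma+\hat\alpha_n(p_n))]$. Output the optimal decisions retrieved along the optimality equations starting from $V_1(0)$, together with the supportive decisions attaining $\mathcal R_s$ at the terminal $\gamma$. **UCB-Add-On algorithm** (parameter $\varepsilon$). It maintains, initialized at $0$: counters $c_n(p)$ and $c_{N+m}(p)$, the numbers of periods in which price $p$ has been used for core product $n$ (resp. supportive product $m$); $c^{(a,1)}_{N+m}(p')$, the number of core products purchased when supportive product $m$ is selected for add-on discount at discount price $p'$; $c^{(a,2)}_{N+m}(p)$, the number of core products purchased when supportive product $m$ is not selected for add-on discount and is offered at original price $p$; and the corresponding empirical averages $\bar\alpha_n(p),\bar\alpha_{N+m}(p),\bar\beta'_{N+m}(p'),\bar\beta_{N+m}(p)$. Time is divided into episodes $\tau=1,2,\dots$. At the first period $t$ of episode $\tau$, for every parameter it forms $\min\big(1,\ \text{empirical average}+\sqrt{2\log t/\text{counter}}\big)$ (equal to $1$ when the counter is $0$), and runs the Discretized DP Algorithm with these values as demand functions and $K=\lceil\sqrt t/\varepsilon\rceil$, obtaining policy $\Pi_\tau$. It keeps using $\Pi_\tau$, updating the averages and counters in each period, and terminates the episode when the value of at least one of the counters associated with the selected add-on products and prices under $\Pi_\tau$ is doubled within the episode. **Regret.** With $\Pi_t$ the policy used by the algorithm in period $t$, $\mathrm{Regret}(T)=\mathbf E\big[\sum_{t=1}^T(\mathcal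 R^*-\mathcal R(\Pi_t))\big]$. *)

(* Defs.v *)
(* All randomness is finite, so expectations are finite sums; MathComp-Analysis
   is used for the reals and the logarithm only. *)
From HB Require Import structures.
From mathcomp Require Import all_boot all_order all_fingroup all_algebra.
From mathcomp Require Import finmap reals exp.

Set Implicit Arguments.
Unset Strict Implicit.
Unset Printing Implicit Defensive.

Import Order.TTheory GRing.Theory Num.Theory.
Local Open Scope fset_scope.
Local Open Scope ring_scope.

(* The data known to the retailer: N, M, S and the three price sets. *)
Record problem (R : realType) := Problem {
  ncore : nat;
  nsupp : nat;
  cap : nat;
  core_prices : {fset R};
  supp_prices : {fset R};
  addon_prices : {fset R} }.

(* alpha_n, alpha_{N+m}, beta_{N+m} and beta'_{N+m}.  The same type holds the
   true demand functions and the optimistic estimates of them. *)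
Record demand (R : realType) (X : problem R) := Demand {
  core_rate : 'I_(ncore X) -> core_prices X -> R;
  supp_rate : 'I_(nsupp X) -> supp_prices X -> R;
  orig_rate : 'I_(nsupp X) -> supp_prices X -> R;
  disc_rate : 'I_(nsupp X) -> addon_prices X -> R }.

(* (p_n)_n, (p_{N+m})_m, (p'_{N+m})_m and {m | I_{N+m} = 1}. *)
Definition policy (R : realType) (X : problem R) : Type :=
  ({ffun 'I_(ncore X) -> core_prices X} *
   {ffun 'I_(nsupp X) -> supp_prices X} *
   {ffun 'I_(nsupp X) -> addon_prices X} *
   {set 'I_(nsupp X)})%type.
HB.instance Definition _ (R : realType) (X : problem R) :=
  Finite.on (@policy R X).

(* One period: the primary demands (at most one unit of each product), and
   whether the customer who purchased core product n adds supportive product m.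
   These are exactly the purchases, all of them observed. *)
Definition outcome (R : realType) (X : problem R) : Type :=
  ({ffun 'I_(ncore X) -> bool} *
   {ffun 'I_(nsupp X) -> bool} *
   {ffun 'I_(ncore X) * 'I_(nsupp X) -> bool})%type.
HB.instance Definition _ (R : realType) (X : problem R) :=
  Finite.on (@outcome R X).

Section Offline.
Context {R : realType} {X : problem R}.
Implicit Types (d : demand X) (pi : policy X) (o : outcome X).
Local Notation N := (ncore X).
Local Notation M := (nsupp X).

Definition core_price pi (n : 'I_N) : core_prices X := pi.1.1.1 n.
Definition supp_price pi (m : 'I_M) : supp_prices X := pi.1.1.2 m.
Definition disc_price pi (m : 'I_M) : addon_prices X := pi.1.2 m.
Definition selected pi : {set 'I_M} := pi.2.

Definition nonneg_prices : Prop :=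
  forall x : R,
    x \in core_prices X `|` supp_prices X `|` addon_prices X -> 0 <= x.

Definition in_unit (x : R) : bool := 0 <= x <= 1.

Definition demand_in_unit d : Prop :=
  [/\ forall n p, in_unit (core_rate d n p),
      forall m p, in_unit (supp_rate d m p),
      forall m p, in_unit (orig_rate d m p) &
      forall m p, in_unit (disc_rate d m p)].

Definition feasible pi : bool :=
  (#|selected pi| <= cap X)%N &&
  [forall m, val (disc_price pi m) < val (supp_price pi m)].

Definition revenue d pi : R :=
  \sum_(n < N) core_rate d n (core_price pi n) * val (core_price pi n)
  + \sum_(m < M) supp_rate d m (supp_price pi m) * val (supp_price pi m)
  + (\sum_(n < N) core_rate d n (core_price pi n)) *
    \sum_(m < M)
      (if m \in selected pi
       then disc_rate d m (disc_price pi m) * val (disc_price pi m)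
       else orig_rate d m (supp_price pi m) * val (supp_price pi m)).

(* Prices and demand rates being nonnegative, the default value 0 of this
   maximum and of the maxima below is harmless as soon as their range is not
   empty. *)
Definition opt_revenue d : R :=
  \big[Num.max/0]_(pi : policy X | feasible pi) revenue d pi.

Definition max_price : R :=
  \big[Num.max/0]_(x <- core_prices X `|` supp_prices X) x.

Definition largest_set : nat :=
  maxn #|` core_prices X| (maxn #|` supp_prices X| #|` addon_prices X|).

Definition bernoulli_mass (q : R) (b : bool) : R := if b then q else 1 - q.

Definition addon_rate d pi (m : 'I_M) : R :=
  if m \in selected pi then disc_rate d m (disc_price pi m)
  else orig_rate d m (supp_price pi m).

(* Law of the outcome of a period in which pi is used: independent primary
   demands, then independent add-on decisions of every customer who purchased
   a core product; there is no add-on purchase without a core purchase. *)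
Definition outcome_law d pi o : R :=
  (\prod_(n < N) bernoulli_mass (core_rate d n (core_price pi n)) (o.1.1 n)) *
  (\prod_(m < M) bernoulli_mass (supp_rate d m (supp_price pi m)) (o.1.2 m)) *
  \prod_(n < N) \prod_(m < M)
    bernoulli_mass (if o.1.1 n then addon_rate d pi m else 0) (o.2 (n, m)).

Definition core_purchases o : nat := \sum_(n < N) o.1.1 n.
Definition addon_purchases o (m : 'I_M) : nat := \sum_(n < N) o.2 (n, m).
Definition total_primary o : nat :=
  (core_purchases o + \sum_(m < M) o.1.2 m)%N.

(* Lowest probability, over the feasible policies, that the total primary
   demand (core and supportive products) is non-zero.  Counting core products
   only, or ranging over more price vectors, can only give a smaller value. *)
Definition lambda d : R :=
  \big[Num.min/1]_(pi : policy X | feasible pi)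
    \sum_(o : outcome X | total_primary o != 0%N) outcome_law d pi o.

(* Discretized DP; the grid point k stands for gamma = k / K. *)
Section DiscretizedDP.
Variables (d : demand X) (K : nat).

Definition grid (k : nat) : R := k%:R / K%:R.

Definition obj_orig (k : nat) (m : 'I_M) (p : supp_prices X) : R :=
  supp_rate d m p * val p + grid k * (orig_rate d m p * val p).

Definition obj_disc (k : nat) (m : 'I_M)
    (p : supp_prices X) (p' : addon_prices X) : R :=
  supp_rate d m p * val p + grid k * (disc_rate d m p' * val p').

Definition best_orig (k : nat) (m : 'I_M) : R :=
  \big[Num.max/0]_(p : supp_prices X) obj_orig k m p.

Definition best_disc (k : nat) (m : 'I_M) : R :=
  \big[Num.max/0]_(q : supp_prices X * addon_prices X | val q.2 < val q.1)
    obj_disc k m q.1 q.2.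

Definition gain (k : nat) (m : 'I_M) : R := best_disc k m - best_orig k m.

(* sigma k i is the product in position i of the list sorted at k; any
   resolution of ties is allowed. *)
Definition sorts_gains (sigma : nat -> 'S_M) : Prop :=
  forall (k : nat) (i j : 'I_M), (k <= N * K)%N -> (i <= j)%N ->
    gain k (sigma k j) <= gain k (sigma k i).

Definition sel (sigma : nat -> 'S_M) (k : nat) : {set 'I_M} :=
  [set m | (0 < gain k m) && (((sigma k)^-1)%g m < cap X)%N].

Definition supp_value (sigma : nat -> 'S_M) (k : nat) : R :=
  \sum_(m < M) (best_orig k m + (m \in sel sigma k)%:R * gain k m).

(* alpha_n(p) rounds to rnd n p / K; either neighbour of a midpoint is
   allowed. *)
Definition nearest (rnd : 'I_N -> core_prices X -> nat) : Prop :=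
  forall n p (j : int),
    `|core_rate d n p - grid (rnd n p)| <= `|core_rate d n p - j%:~R / K%:R|.

Section Value.
Variables (sigma : nat -> 'S_M) (rnd : 'I_N -> core_prices X -> nat).

Fixpoint value_along (s : seq 'I_N) (k : nat) : R :=
  if s is n :: s' then
    \big[Num.max/0]_(p : core_prices X)
      (core_rate d n p * val p + value_along s' (k + rnd n p)%N)
  else supp_value sigma k.

(* With core products numbered from 0: V_n, and V_N = R_s. *)
Definition value (n : nat) : nat -> R := value_along (drop n (enum 'I_N)).

Definition reached pi (n : nat) : nat :=
  \sum_(i < N | (i < n)%N) rnd i (core_price pi i).

Definition core_optimal pi : Prop :=
  forall n : 'I_N, let p := core_price pi n in let k := reached pi n in
    core_rate d n p * val p + value n.+1 (k + rnd n p)%N = value n k.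

Definition supp_optimal pi : Prop :=
  let k := reached pi N in
  selected pi = sel sigma k /\
  forall m, let p := supp_price pi m in let p' := disc_price pi m in
    if m \in selected pi
    then val p' < val p /\ obj_disc k m p p' = best_disc k m
    else obj_orig k m p = best_orig k m.
End Value.

(* pi is a possible output on d and K.  The discount price of an unselected
   product is left free: no step of the algorithm uses it. *)
Definition ddp_output pi : Prop :=
  exists (sigma : nat -> 'S_M) (rnd : 'I_N -> core_prices X -> nat),
    [/\ sorts_gains sigma, nearest rnd,
        core_optimal sigma rnd pi & supp_optimal sigma rnd pi].
End DiscretizedDP.
End Offline.

Section Online.
Context {R : realType} {X : problem R}.
Local Notation N := (ncore X).
Local Notation M := (nsupp X).

(* A learning algorithm maps the outcomes of the past periods, oldest first,
   to the policy used in the next period. *)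
Definition learner : Type := seq (outcome X) -> policy X.

Definition log : Type := seq (policy X * outcome X).

Definition log_of (run : learner) (h : seq (outcome X)) : log :=
  zip [seq run (take i h) | i <- iota 0 (size h)] h.

Implicit Types (L : log) (run : learner) (h : seq (outcome X)).

Definition cnt_core L (n : 'I_N) (p : core_prices X) : nat :=
  \sum_(x <- L | core_price x.1 n == p) 1.
Definition sum_core L (n : 'I_N) (p : core_prices X) : nat :=
  \sum_(x <- L | core_price x.1 n == p) x.2.1.1 n.

Definition cnt_supp L (m : 'I_M) (p : supp_prices X) : nat :=
  \sum_(x <- L | supp_price x.1 m == p) 1.
Definition sum_supp L (m : 'I_M) (p : supp_prices X) : nat :=
  \sum_(x <- L | supp_price x.1 m == p) x.2.1.2 m.

(* c^(a,1) and c^(a,2) count core products purchased, not periods. *)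
Definition cnt_disc L (m : 'I_M) (p : addon_prices X) : nat :=
  \sum_(x <- L | (m \in selected x.1) && (disc_price x.1 m == p))
    core_purchases x.2.
Definition sum_disc L (m : 'I_M) (p : addon_prices X) : nat :=
  \sum_(x <- L | (m \in selected x.1) && (disc_price x.1 m == p))
    addon_purchases x.2 m.

Definition cnt_orig L (m : 'I_M) (p : supp_prices X) : nat :=
  \sum_(x <- L | (m \notin selected x.1) && (supp_price x.1 m == p))
    core_purchases x.2.
Definition sum_orig L (m : 'I_M) (p : supp_prices X) : nat :=
  \sum_(x <- L | (m \notin selected x.1) && (supp_price x.1 m == p))
    addon_purchases x.2 m.

Definition ucb (t total count : nat) : R :=
  if count == 0%N then 1
  else Num.min 1 (total%:R / count%:R + Num.sqrt (2 * ln t%:R / count%:R)).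

Definition ucb_demand (t : nat) L : demand X :=
  Demand (fun n p => ucb t (sum_core L n p) (cnt_core L n p))
         (fun m p => ucb t (sum_supp L m p) (cnt_supp L m p))
         (fun m p => ucb t (sum_orig L m p) (cnt_orig L m p))
         (fun m p => ucb t (sum_disc L m p) (cnt_disc L m p)).

(* A counter equal to 0 at the start of the episode counts as doubled as soon
   as it becomes positive. *)
Definition doubled (c0 c : nat) : bool := (c0 < c)%N && (c0.*2 <= c)%N.

(* L0 and L are the logs at the start of the episode and now; pi is the policy
   of the episode. *)
Definition episode_ends (pi : policy X) (L0 L : log) : bool :=
  let dbl (c : log -> nat) := doubled (c L0) (c L) in
  [exists n, dbl (fun l => cnt_core l n (core_price pi n))] ||
  [exists m, dbl (fun l => cnt_supp l m (supp_price pi m)) ||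
     (if m \in selected pi
      then dbl (fun l => cnt_disc l m (disc_price pi m))
      else dbl (fun l => cnt_orig l m (supp_price pi m)))].

(* Number of periods that precede the episode to which period j.+1 belongs. *)
Fixpoint episode_start run h (j : nat) : nat :=
  if j is j'.+1 then
    let s := episode_start run h j' in
    if episode_ends (run (take s h)) (log_of run (take s h))
                    (log_of run (take j h))
    then j else s
  else 0.

Definition grid_size (eps : R) (t : nat) : nat :=
  `|Num.ceil (Num.sqrt t%:R / eps)|%N.

Definition ucb_add_on (eps : R) run : Prop :=
  forall h, let s := episode_start run h (size h) in
    if s == size h then
      let t := (size h).+1 in
      ddp_output (ucb_demand t (log_of run h)) (grid_size eps t) (run h)
    else run h = run (take s h).

Definition trajectory_law (d : demand X) run (T : nat)
    (h : T.-tuple (outcome X)) : R :=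
  \prod_(i < T) outcome_law d (run (take i h)) (tnth h i).

Definition regret (d : demand X) run (T : nat) : R :=
  \sum_(h : T.-tuple (outcome X))
    trajectory_law d run h *
    \sum_(i < T) (opt_revenue d - revenue d (run (take i h))).
End Online.

Arguments nonneg_prices {R} X.
Arguments max_price {R} X.
Arguments largest_set {R} X.
Arguments learner {R} X.

(* Main.v *)
(** The algorithm is optimistic: unless some estimate is misleading, every upper
    confidence bound dominates the true rate, so the regret of a period is at
    most the discretization error plus what the bounds overestimate at the
    policy in use.  An overestimation of an add-on rate enters the revenue
    multiplied by the total core demand rate, which is exactly the expected
    increase of the corresponding counter of core purchases; the confidence
    radii therefore sum to a telescoping square root of the counter, uniformly
    in the law of the demand.  The doubling rule costs only a constant factor,
    and bounds the length of an episode by its starting time, so that neither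
    the grid nor the logarithm is too stale.

    The counters grow by random, adaptively chosen batches of up to N trials, and
    a union bound over their values would cost a power of N.  Instead, an
    exponential supermartingale whose tilt is readjusted to the counter gives a
    failure probability that depends on the number of periods alone. *)
Require Import Defs.
From HB Require Import structures.
From mathcomp Require Import classical_sets topology normedtype derive realfun.
From mathcomp Require Import all_boot all_order all_fingroup all_algebra.
From mathcomp Require Import finmap reals sequences exp zify ring lra.

Set Implicit Arguments.
Unset Strict Implicit.
Unset Printing Implicit Defensive.

Import Order.TTheory GRing.Theory Num.Theory.
Import numFieldNormedType.Exports.
Local Open Scope ring_scope.

(** * Hoeffding's lemma for a Bernoulli variable *)

(** The analysis never conditions on a good event. All rates lie in the unit interval, so the
    indicator that an arm fails is itself a bound on the error of its estimate. Indicators and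
    confidence radii are added linearly through the revenue, and expectations are taken arm by arm
    over a family fixed in advance, whatever policy the data suggest.

    With L about ln t, a deviation of sqrt (2 L c) is exceeded in t periods with probability of
    order t * t^-2 = 1 / t, so failures cost of order N M U ln T in total. This cost, and the
    constant that small counters add, are below sqrt (U T ln T) only when T exceeds U ln T; for
    shorter horizons T times a bound on the revenue of a period suffices.

    A difference of revenues contains a difference of products, core demand times add-on revenue,
    which can be expanded so that the add-on error is multiplied by either of the two core demands.
    At the policy in use the true core demand is chosen, because it is the one that drives the
    counter. *)

Lemma derive_ge0_le (R : realType) (f df : R -> R) (x : R) :
  (forall y : R, 0 <= y -> is_derive y 1 f (df y)) ->
  (forall y : R, 0 <= y -> 0 <= df y) -> 0 <= x -> f 0 <= f x.
Proof.
move=> fdf df0 x0; rewrite -subr_ge0.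
have [||c] := @MVT_segment R f df 0 x x0.
- by move=> y; rewrite in_itv/= => /andP[/ltW y0 _]; exact: fdf.
- apply: derivable_within_continuous => y; rewrite in_itv/= => /andP[y0 _].
  exact: (@ex_derive _ _ _ _ _ _ _ (fdf y y0)).
- by rewrite in_itv/= => /andP[c0 _] ->; rewrite subr0 mulr_ge0 ?df0.
Qed.

(** The logarithm of the moment generating function is compared with its bound: [g] vanishes at 0
    together with its derivative [g'], and the second derivative 1/4 - (1 - q) q e^y / a(y)^2 is
    nonnegative. *)
Lemma hoeffding_bernoulli_ge0 (R : realType) (q x : R) : 0 <= q <= 1 -> 0 <= x ->
  q * expR (x * (1 - q)) + (1 - q) * expR (x * (0 - q)) <= expR (x ^+ 2 / 8).
Proof.
move=> /andP[q0 q1] x0.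
pose a (y : R) := 1 - q + q * expR y.
have a_gt0 y : 0 <= y -> 0 < a y.
  move=> y0; rewrite /a; have := expR_ge1Dx y => ?.
  have : 1 <= expR y by lra.
  by nra.
have da (y : R) : is_derive y 1 a (q * expR y).
  rewrite /a; apply: is_derive_eq; rewrite /GRing.scale/=; ring.
have dlna (y : R) : 0 <= y -> is_derive y 1 (fun z => ln (a z)) ((a y)^-1 * (q * expR y)).
  move=> y0; have ? := is_derive1_ln (a_gt0 y y0).
  exact: is_derive1_comp.
pose g' (y : R) := y / 4 + q - (a y)^-1 * (q * expR y).
pose g (y : R) := y ^+ 2 / 8 + q * y - ln (a y).
have g'_ge0 y : 0 <= y -> 0 <= g' y.
  move=> y0.
  have -> : 0 = g' 0 by rewrite /g' /a expR0; field; lra.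
  apply: (@derive_ge0_le _ g' (fun y => 1/4 - (1 - q) * (q * expR y) / a y ^+ 2)) => // z z0.
    have ? := a_gt0 z z0.
    have az : a z != 0 by rewrite gt_eqF.
    have ? : is_derive z 1 (fun y => (a y)^-1) _ := is_deriveV az (da z).
    rewrite /g'; apply: is_derive_eq; rewrite /GRing.scale/= /a; field.
    exact: az.
  have ? := a_gt0 z z0.
  rewrite subr_ge0 ler_pdivrMr ?exprn_gt0// /a.
  (* AM-GM for the two terms of [a z]: their product is at most a quarter of the square of their
     sum. *)
  have := sqr_ge0 (1 - q - q * expR z); nra.
have g_ge0 : 0 <= g x.
  have -> : 0 = g 0 by rewrite /g /a expR0 expr0n/= mul0r mulr0 mulr1 subrK ln1; ring.
  apply: (@derive_ge0_le _ g g') => // z z0.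
  have ? := dlna z z0.
  rewrite /g /g'; apply: is_derive_eq; rewrite /GRing.scale/=; field.
  by rewrite gt_eqF ?a_gt0.
have -> : q * expR (x * (1 - q)) + (1 - q) * expR (x * (0 - q)) =
    a x * expR (- (q * x)).
  rewrite /a (_ : x * (1 - q) = x + - (q * x)); last ring.
  rewrite (_ : x * (0 - q) = - (q * x)); last ring.
  rewrite expRD; ring.
rewrite -(@lnK _ (a x)) ?posrE ?a_gt0// -expRD ler_expR.
move: g_ge0; rewrite /g; lra.
Qed.

(** Exchanging success and failure turns [q] into [1 - q] and [x] into [- x], which reduces a
    negative tilt to a positive one. *)
Lemma hoeffding_bernoulli (R : realType) (q x : R) : 0 <= q <= 1 ->
  q * expR (x * (1 - q)) + (1 - q) * expR (x * (0 - q)) <= expR (x ^+ 2 / 8).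
Proof.
move=> q01; have [x0|x0] := leP 0 x; first exact: hoeffding_bernoulli_ge0.
rewrite -sqrrN; have q01' : 0 <= 1 - q <= 1 by lra.
have x0' : 0 <= - x by lra.
apply: le_trans (hoeffding_bernoulli_ge0 q01' x0').
rewrite addrC le_eqVlt; apply/orP; left; apply/eqP.
by congr (_ * expR _ + _ * expR _); ring.
Qed.

(** * Expectations over outcomes and histories *)

Section BernoulliMass.
Context {R : realType}.
Implicit Types q : R.

Lemma sum_bernoulli q (f : bool -> R) :
  \sum_b bernoulli_mass q b * f b = q * f true + (1 - q) * f false.
Proof. by rewrite big_bool. Qed.

Lemma sum_bernoulli1 q : \sum_b bernoulli_mass q b = 1.
Proof. by rewrite big_bool /=; ring. Qed.

Lemma bernoulli_mass_ge0 q b : in_unit q -> 0 <= bernoulli_mass q b.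
Proof. by move=> /andP[q0 q1]; case: b => /=; lra. Qed.

Lemma sum_ffun_prod (I : finType) (w : I -> bool -> R) :
  \sum_(z : {ffun I -> bool}) \prod_i w i (z i) = \prod_i \sum_b w i b.
Proof. by rewrite bigA_distr_bigA. Qed.

Lemma sum_bernoulli_prod (I : finType) (q : I -> R) :
  \sum_(z : {ffun I -> bool}) \prod_i bernoulli_mass (q i) (z i) = 1.
Proof.
rewrite (sum_ffun_prod (fun i => bernoulli_mass (q i))).
by rewrite big1 // => i _; rewrite sum_bernoulli1.
Qed.

Lemma sum_bernoulli_marginal (I : finType) (q : I -> R) (i : I) (f : bool -> R) :
  \sum_(z : {ffun I -> bool}) (\prod_j bernoulli_mass (q j) (z j)) * f (z i) =
  \sum_b bernoulli_mass (q i) b * f b.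
Proof.
pose w j b := bernoulli_mass (q j) b * (if j == i then f b else 1).
transitivity (\sum_(z : {ffun I -> bool}) \prod_j w j (z j)).
  apply: eq_bigr => z _; rewrite big_split /=; congr (_ * _).
  by rewrite (bigD1 i) //= eqxx big1 ?mulr1 // => j /negPf ->.
rewrite sum_ffun_prod (bigD1 i) //= [X in _ * X]big1 ?mulr1 => [|j /negPf ji].
  by apply: eq_bigr => b _; rewrite /w eqxx.
by rewrite -[RHS](sum_bernoulli1 (q j)); apply: eq_bigr => b _; rewrite /w ji mulr1.
Qed.

End BernoulliMass.

Section OutcomeExpectation.
Context {R : realType} {X : problem R}.
Local Notation N := (ncore X).
Local Notation M := (nsupp X).
Implicit Types (d : demand X) (pi : policy X).

Definition expect d pi (f : outcome X -> R) : R :=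
  \sum_o outcome_law d pi o * f o.

Lemma outcome_law_ge0 d pi o : demand_in_unit d -> 0 <= outcome_law d pi o.
Proof.
case=> d1 d2 d3 d4; rewrite /outcome_law.
rewrite !mulr_ge0 ?prodr_ge0 // => [n _|m _|n _]; try exact: bernoulli_mass_ge0.
apply: prodr_ge0 => m _; apply: bernoulli_mass_ge0; rewrite /addon_rate.
by case: ifP => // _; [case: ifP|rewrite /in_unit lexx ler01].
Qed.

Lemma expect_triple d pi f : expect d pi f =
  \sum_(x : {ffun 'I_N -> bool}) \sum_(y : {ffun 'I_M -> bool})
    \sum_(z : {ffun 'I_N * 'I_M -> bool})
      outcome_law d pi (x, y, z) * f (x, y, z).
Proof.
rewrite /expect; under [RHS]eq_bigr do rewrite pair_bigA /=.
rewrite pair_bigA /=.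
rewrite (reindex (fun u : {ffun 'I_N -> bool} *
   ({ffun 'I_M -> bool} * {ffun 'I_N * 'I_M -> bool}) =>
   ((u.1, u.2.1, u.2.2) : outcome X))) //=.
by exists (fun o : outcome X => (o.1.1, (o.1.2, o.2))) => [[x [y z]]|[[x y] z]].
Qed.

(** Given the core demands, the add-on decisions are independent, so they can be integrated out
    factor by factor. The factors [chi] may depend on the whole vector of core demands, because the
    tilts used below depend on the number of core purchases. *)
Lemma expect_addons d pi (g : {ffun 'I_N -> bool} -> {ffun 'I_M -> bool} -> R)
    (chi : {ffun 'I_N -> bool} -> 'I_N -> 'I_M -> bool -> R) :
  expect d pi (fun o => g o.1.1 o.1.2 *
      \prod_n \prod_m chi o.1.1 n m (o.2 (n, m))) =
  expect d pi (fun o => g o.1.1 o.1.2 *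
      \prod_n \prod_m \sum_b
        bernoulli_mass (if o.1.1 n then addon_rate d pi m else 0) b *
        chi o.1.1 n m b).
Proof.
rewrite !expect_triple; apply: eq_bigr => x _; apply: eq_bigr => y _.
pose q (u : 'I_N * 'I_M) := if x u.1 then addon_rate d pi u.2 else 0.
rewrite /outcome_law /=.
set P := (\prod_(n < N) bernoulli_mass (core_rate d n _) _).
set Q := (\prod_(m < M) bernoulli_mass (supp_rate d m _) _).
have qE z : \prod_(n < N) \prod_(m < M)
    bernoulli_mass (if x n then addon_rate d pi m else 0) (z (n, m)) =
    \prod_u bernoulli_mass (q u) (z u).
  by rewrite pair_bigA /=; apply: eq_bigr => -[].
transitivity (P * Q * g x y *
    \sum_(z : {ffun 'I_N * 'I_M -> bool})
      \prod_u (bernoulli_mass (q u) (z u) * chi x u.1 u.2 (z u))).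
  rewrite mulr_sumr; apply: eq_bigr => z _.
  rewrite qE pair_bigA /= big_split /=.
  rewrite (eq_bigr (fun u => chi x u.1 u.2 (z u))
    (F1 := fun u => chi x u.1 u.2 (z (u.1, u.2)))) => [|[]//].
  ring.
rewrite (sum_ffun_prod (fun u b => bernoulli_mass (q u) b * chi x u.1 u.2 b)).
transitivity (P * Q * g x y *
  (\prod_n \prod_m \sum_b
     bernoulli_mass (if x n then addon_rate d pi m else 0) b * chi x n m b) *
  \sum_(z : {ffun 'I_N * 'I_M -> bool}) \prod_u bernoulli_mass (q u) (z u)).
  by rewrite sum_bernoulli_prod mulr1 pair_bigA.
by rewrite mulr_sumr; apply: eq_bigr => z _; rewrite qE; ring.
Qed.

Lemma expect_primary d pi (g : {ffun 'I_N -> bool} -> {ffun 'I_M -> bool} -> R) :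
  expect d pi (fun o => g o.1.1 o.1.2) =
  \sum_(x : {ffun 'I_N -> bool}) \sum_(y : {ffun 'I_M -> bool})
    (\prod_n bernoulli_mass (core_rate d n (core_price pi n)) (x n)) *
    (\prod_m bernoulli_mass (supp_rate d m (supp_price pi m)) (y m)) * g x y.
Proof.
rewrite expect_triple; apply: eq_bigr => x _; apply: eq_bigr => y _.
rewrite /= -mulr_suml; congr (_ * _); rewrite /outcome_law /= -mulr_sumr.
rewrite -[RHS]mulr1; congr (_ * _).
rewrite -[RHS](@sum_bernoulli_prod R ('I_N * 'I_M)%type
  (fun u => if x u.1 then addon_rate d pi u.2 else 0)).
by apply: eq_bigr => z _; rewrite pair_bigA /=; apply: eq_bigr => -[].
Qed.

Lemma expect_core d pi n (f : bool -> R) :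
  expect d pi (fun o => f (o.1.1 n)) =
  \sum_b bernoulli_mass (core_rate d n (core_price pi n)) b * f b.
Proof.
rewrite (expect_primary d pi (fun x _ => f (x n))).
rewrite -(sum_bernoulli_marginal (fun n => core_rate d n (core_price pi n))).
apply: eq_bigr => x _; rewrite -mulr_suml -mulr_sumr.
by rewrite sum_bernoulli_prod mulr1.
Qed.

Lemma expect_supp d pi m (f : bool -> R) :
  expect d pi (fun o => f (o.1.2 m)) =
  \sum_b bernoulli_mass (supp_rate d m (supp_price pi m)) b * f b.
Proof.
rewrite (expect_primary d pi (fun _ y => f (y m))) exchange_big /=.
rewrite -(sum_bernoulli_marginal (fun m => supp_rate d m (supp_price pi m))).
apply: eq_bigr => y _; rewrite -mulr_suml -mulr_suml.
by rewrite sum_bernoulli_prod mul1r.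
Qed.

Lemma expect_cst d pi (c : R) : expect d pi (fun=> c) = c.
Proof.
rewrite (expect_primary d pi (fun _ _ => c)).
under eq_bigr do rewrite -mulr_suml -mulr_sumr sum_bernoulli_prod mulr1.
by rewrite -mulr_suml sum_bernoulli_prod mul1r.
Qed.

Lemma expectD d pi f g :
  expect d pi (fun o => f o + g o) = expect d pi f + expect d pi g.
Proof. by rewrite -big_split; apply: eq_bigr => o _; rewrite mulrDr. Qed.

Lemma expectZ d pi (c : R) f :
  expect d pi (fun o => c * f o) = c * expect d pi f.
Proof. by rewrite mulr_sumr; apply: eq_bigr => o _; rewrite mulrCA. Qed.

Lemma expect_sum (I : Type) (r : seq I) (P : pred I) d pi (f : I -> outcome X -> R) :
  expect d pi (fun o => \sum_(i <- r | P i) f i o) =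
  \sum_(i <- r | P i) expect d pi (f i).
Proof.
by rewrite /expect exchange_big /=; apply: eq_bigr => o _; rewrite mulr_sumr.
Qed.

Lemma eq_expect d pi f g : f =1 g -> expect d pi f = expect d pi g.
Proof. by move=> fg; apply: eq_bigr => o _; rewrite fg. Qed.

Lemma le_expect d pi f g : demand_in_unit d ->
  (forall o, outcome_law d pi o != 0 -> f o <= g o) ->
  expect d pi f <= expect d pi g.
Proof.
move=> hd fg; apply: ler_sum => o _.
have [->|o0] := eqVneq (outcome_law d pi o) 0; first by rewrite !mul0r.
by rewrite ler_wpM2l ?outcome_law_ge0 ?fg.
Qed.

Lemma expect_core_purchases d pi :
  expect d pi (fun o => (core_purchases o)%:R) =
  \sum_(n < N) core_rate d n (core_price pi n).
Proof.
under eq_expect do rewrite /core_purchases natr_sum.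
rewrite expect_sum; apply: eq_bigr => n _.
by rewrite (expect_core d pi n (fun b => b%:R)) sum_bernoulli mulr1 mulr0 addr0.
Qed.

End OutcomeExpectation.

Section HistoryExpectation.
Context {R : realType} {X : problem R}.
Variables (d : demand X) (run : @learner R X).
Implicit Types (h : seq (outcome X)) (F G : seq (outcome X) -> R).

(** The tower property is built into the recursion: the innermost expectation is that of the last
    period given the past. Supermartingale and telescoping arguments thereby become inductions on
    [i]. *)
Fixpoint hexpect (i : nat) F : R :=
  if i is i'.+1 then
    hexpect i' (fun h => expect d (run h) (fun o => F (rcons h o)))
  else F [::].

Lemma eq_hexpect i F G : (forall h, size h = i -> F h = G h) ->
  hexpect i F = hexpect i G.
Proof.
elim: i F G => [|i IH] F G FG /=; first exact: FG.
by apply: IH => h hi; apply: eq_expect => o; rewrite FG // size_rcons hi.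
Qed.

Lemma hexpect_trajectory T F :
  \sum_(h : T.-tuple (outcome X)) trajectory_law d run h * F h = hexpect T F.
Proof.
elim: T F => [|T IH] F /=.
  rewrite (big_pred1 ([tuple] : 0.-tuple (outcome X))) => [|h]; last by rewrite (tuple0 h) /= eqxx.
  by rewrite /trajectory_law big_ord0 mul1r.
rewrite -IH.
pose f (u : T.-tuple (outcome X) * outcome X) : T.+1.-tuple _ :=
  [tuple of rcons u.1 u.2].
have f_inj : injective f.
  move=> [h o] [h' o'] /(congr1 val) /= /rcons_inj [hh' ->]; congr (_, _).
  exact: val_inj.
rewrite (reindex f) /=; last first.
  by apply/onW_bij/inj_card_bij => //; rewrite card_prod !card_tuple expnSr.
rewrite -(pair_bigA _ (fun (h : T.-tuple _) o =>
  trajectory_law d run (f (h, o)) * F (f (h, o)))) /=.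
apply: eq_bigr => h _; rewrite /expect mulr_sumr; apply: eq_bigr => o _.
rewrite mulrA; congr (_ * _).
rewrite /trajectory_law big_ord_recr /=; congr (_ * _).
  apply: eq_bigr => i _; congr outcome_law.
    by rewrite -cats1 takel_cat // size_tuple ltnW.
  by rewrite !(tnth_nth o) /= nth_rcons size_tuple ltn_ord.
rewrite -cats1 takel_cat ?size_tuple // take_oversize ?size_tuple //.
by congr outcome_law; rewrite (tnth_nth o) /= nth_rcons size_tuple ltnn eqxx.
Qed.

Lemma hexpectD i F G : hexpect i (fun h => F h + G h) = hexpect i F + hexpect i G.
Proof.
elim: i F G => [|i IH] F G //=.
by rewrite -IH; apply: eq_hexpect => h _; rewrite expectD.
Qed.

Lemma hexpectZ i c F : hexpect i (fun h => c * F h) = c * hexpect i F.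
Proof.
elim: i F => [|i IH] F //=.
by rewrite -IH; apply: eq_hexpect => h _; rewrite expectZ.
Qed.

Lemma hexpect_cst i c : hexpect i (fun=> c) = c.
Proof.
by elim: i => [|i IH] //=; rewrite -[RHS]IH; apply: eq_hexpect => h _; rewrite expect_cst.
Qed.

Lemma hexpect_sum (I : Type) (r : seq I) (P : pred I) i (F : I -> seq (outcome X) -> R) :
  hexpect i (fun h => \sum_(k <- r | P k) F k h) =
  \sum_(k <- r | P k) hexpect i (F k).
Proof.
elim: i F => [|i IH] F //=.
by rewrite -IH; apply: eq_hexpect => h _; rewrite expect_sum.
Qed.

Lemma hexpect_steps T (g : seq (outcome X) -> R) :
  hexpect T (fun h => \sum_(i < T) g (take i h)) = \sum_(i < T) hexpect i g.
Proof.
elim: T => [|T IH]; first by rewrite /= !big_ord0.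
rewrite big_ord_recr -IH /= -hexpectD; apply: eq_hexpect => h hT.
rewrite -[RHS](expect_cst d (run h)); apply: eq_expect => o.
rewrite big_ord_recr /=; congr (_ + _).
  by apply: eq_bigr => i _; rewrite -cats1 takel_cat // hT ltnW.
by rewrite -cats1 takel_cat ?hT // take_oversize // hT.
Qed.

Hypothesis hd : demand_in_unit d.

(** [inv] holds along all histories of non-zero probability; it serves to exclude impossible
    outcomes that the type allows. *)
Lemma le_hexpect_inv (inv : seq (outcome X) -> Prop) i F G :
  inv [::] ->
  (forall h o, inv h -> outcome_law d (run h) o != 0 -> inv (rcons h o)) ->
  (forall h, size h = i -> inv h -> F h <= G h) ->
  hexpect i F <= hexpect i G.
Proof.
move=> inv0 invS; elim: i F G => [|i IH] F G FG /=; first exact: FG.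
apply: IH => h hi ih; apply: le_expect => // o o0.
by apply: FG; [rewrite size_rcons hi|exact: invS].
Qed.

Lemma le_hexpect i F G : (forall h, size h = i -> F h <= G h) ->
  hexpect i F <= hexpect i G.
Proof. by move=> FG; apply: (@le_hexpect_inv (fun=> True)) => // h /FG. Qed.

Lemma regretE T :
  regret d run T = \sum_(i < T) hexpect i (fun h => opt_revenue d - revenue d (run h)).
Proof.
rewrite -hexpect_steps.
exact: (hexpect_trajectory T
  (fun h => \sum_(i < T) (opt_revenue d - revenue d (run (take i h))))).
Qed.

End HistoryExpectation.

(** * Concentration of the empirical rates *)

Section Arms.
Context {R : realType} {X : problem R}.
Local Notation N := (ncore X).
Local Notation M := (nsupp X).
Implicit Types (d : demand X) (pi : policy X) (o : outcome X).

(** An arm stands for one unknown rate: [active] tells which policies sample it, and a period brings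
    [trials] Bernoulli experiments with [wins] successes. Primary demands bring one trial per
    period, add-on purchases one per core purchase; the four kinds of counters are then treated
    together. *)
Record arm := Arm {
  active : policy X -> bool;
  trials : outcome X -> nat;
  wins : outcome X -> nat }.

Definition count_trials (a : arm) (L : @log R X) : nat :=
  \sum_(x <- L | active a x.1) trials a x.2.
Definition count_wins (a : arm) (L : @log R X) : nat :=
  \sum_(x <- L | active a x.1) wins a x.2.

Definition core_arm (n : 'I_N) (p : core_prices X) : arm :=
  Arm (fun pi => core_price pi n == p) (fun=> 1%N) (fun o => o.1.1 n).
Definition supp_arm (m : 'I_M) (p : supp_prices X) : arm :=
  Arm (fun pi => supp_price pi m == p) (fun=> 1%N) (fun o => o.1.2 m).
Definition orig_arm (m : 'I_M) (p : supp_prices X) : arm :=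
  Arm (fun pi => (m \notin selected pi) && (supp_price pi m == p))
      (@core_purchases R X) (fun o => addon_purchases o m).
Definition disc_arm (m : 'I_M) (p : addon_prices X) : arm :=
  Arm (fun pi => (m \in selected pi) && (disc_price pi m == p))
      (@core_purchases R X) (fun o => addon_purchases o m).

(* The last clause is conditional sub-Gaussianity: given its number c of trials,
   the number of wins of an active arm deviates from q c with variance proxy
   c / 4; theta and F may depend on c. *)
Definition sound d (q : R) (B : nat) (a : arm) : Prop :=
  [/\ in_unit q, forall o, (trials a o <= B)%N,
      forall pi o, active a pi -> outcome_law d pi o != 0 ->
        (wins a o <= trials a o)%N &
      forall pi (theta F : nat -> R), active a pi -> (forall c, 0 <= F c) ->
        expect d pi (fun o => F (trials a o) * expR (theta (trials a o) *
          ((wins a o)%:R - q * (trials a o)%:R))) <=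
        expect d pi (fun o => F (trials a o) *
          expR (theta (trials a o) ^+ 2 * (trials a o)%:R / 8))].

Lemma core_arm_sound d n p : demand_in_unit d ->
  sound d (core_rate d n p) 1 (core_arm n p).
Proof.
move=> [hd _ _ _]; split => //= [pi o _ _|pi theta F /eqP <- F0]; first exact: leq_b1.
rewrite !expectZ ler_wpM2l // !mulr1n !mulr1.
rewrite (expect_core d pi n (fun b =>
  expR (theta 1%N * (b%:R - core_rate d n (core_price pi n))))).
rewrite expect_cst sum_bernoulli /=; exact: hoeffding_bernoulli (hd _ _).
Qed.

Lemma supp_arm_sound d m p : demand_in_unit d ->
  sound d (supp_rate d m p) 1 (supp_arm m p).
Proof.
move=> [_ hd _ _]; split => //= [pi o _ _|pi theta F /eqP <- F0]; first exact: leq_b1.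
rewrite !expectZ ler_wpM2l // !mulr1n !mulr1.
rewrite (expect_supp d pi m (fun b =>
  expR (theta 1%N * (b%:R - supp_rate d m (supp_price pi m))))).
rewrite expect_cst sum_bernoulli /=; exact: hoeffding_bernoulli (hd _ _).
Qed.

Lemma addon_wins_le d pi o m : outcome_law d pi o != 0 ->
  (addon_purchases o m <= core_purchases o)%N.
Proof.
rewrite /outcome_law mulf_eq0 negb_or => /andP[_ /prodf_neq0 h].
apply: leq_sum => n _; move: (h n isT) => /prodf_neq0 /(_ m isT).
by case: (o.1.1 n) => /=; [case: (o.2 _)|case: (o.2 _); rewrite /= ?eqxx].
Qed.

(** Given the core demands, the add-on purchases of product [m] are independent Bernoulli variables,
    one for each core purchase. The exponential is a product over customers, carried by [chi];
    customers without a core purchase contribute 1 on both sides, the others are handled by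
    Hoeffding's lemma. *)
Lemma addon_arm_sound d m q (act : policy X -> bool) :
  demand_in_unit d -> in_unit q ->
  (forall pi, act pi -> addon_rate d pi m = q) ->
  sound d q N (Arm act (@core_purchases R X) (fun o => addon_purchases o m)).
Proof.
move=> hd q01 actq; split => //=.
- move=> o; rewrite /core_purchases -[X in (_ <= X)%N]card_ord -sum1_card.
  by apply: leq_sum => n _; exact: leq_b1.
- by move=> pi o _; exact: addon_wins_le.
move=> pi theta F /actq pq F0.
pose c (x : {ffun 'I_N -> bool}) := (\sum_n x n)%N.
pose chi (x : {ffun 'I_N -> bool}) (n : 'I_N) (m' : 'I_M) (b : bool) :=
  if m' == m then expR (theta (c x) * (b%:R - q * (x n)%:R)) else 1.
have -> : expect d pi (fun o => F (core_purchases o) * expR (theta (core_purchases o) *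
    ((addon_purchases o m)%:R - q * (core_purchases o)%:R))) =
  expect d pi (fun o => F (c o.1.1) * \prod_n \prod_m' chi o.1.1 n m' (o.2 (n, m'))).
  apply: eq_expect => o; congr (_ * _).
  transitivity (\prod_n expR (theta (c o.1.1) * ((o.2 (n, m))%:R - q * (o.1.1 n)%:R))).
    rewrite -expR_sum -mulr_sumr sumrB -mulr_sumr -!natr_sum.
    by congr (expR (_ * (_ - _))).
  apply: eq_bigr => n _; rewrite (bigD1 m) //= /chi eqxx big1 ?mulr1 //.
  by move=> m' /negPf ->.
rewrite (expect_addons d pi (fun x _ => F (c x)) chi).
apply: le_expect => // o _; apply: ler_wpM2l => //.
have -> : expR (theta (core_purchases o) ^+ 2 * (core_purchases o)%:R / 8) =
    \prod_(n < N) expR (theta (c o.1.1) ^+ 2 * (o.1.1 n)%:R / 8).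
  by rewrite -expR_sum -mulr_suml -mulr_sumr -natr_sum.
apply: ler_prod => n _; rewrite (bigD1 m) //=.
rewrite [X in _ * X]big1 ?mulr1 => [|m' /negPf m'm]; last first.
  under eq_bigr do rewrite /chi m'm mulr1.
  exact: sum_bernoulli1.
rewrite sum_bernoulli /chi eqxx pq.
case: (o.1.1 n) => /=; last first.
  by rewrite !(mulr0, mul0r, sub0r, subr0, oppr0, add0r, expR0, mul1r) lexx ler01.
rewrite !mulr1 hoeffding_bernoulli // andbT.
case/andP: q01 => q0 q1; rewrite addr_ge0 ?mulr_ge0 ?expR_ge0 //; lra.
Qed.

Lemma orig_arm_sound d m p : demand_in_unit d ->
  sound d (orig_rate d m p) N (orig_arm m p).
Proof.
move=> hd; apply: addon_arm_sound => //; first by case: hd.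
by move=> pi /andP[/negPf mp /eqP <-]; rewrite /addon_rate mp.
Qed.

Lemma disc_arm_sound d m p : demand_in_unit d ->
  sound d (disc_rate d m p) N (disc_arm m p).
Proof.
move=> hd; apply: addon_arm_sound => //; first by case: hd.
by move=> pi /andP[mp /eqP <-]; rewrite /addon_rate mp.
Qed.

Lemma log_of_rcons (run : learner X) h o :
  log_of run (rcons h o) = rcons (log_of run h) (run h, o).
Proof.
rewrite /log_of size_rcons -addn1 iotaD map_cat /= add0n cats1 zip_rcons; last first.
  by rewrite size_map size_iota.
congr (rcons (zip _ _) (run _, _)).
  apply/eq_in_map => i; rewrite mem_iota add0n => /andP[_ ih].
  by rewrite -cats1 takel_cat // ltnW.
by rewrite -cats1 takel_cat // take_size.
Qed.

Lemma count_trials_rcons a L pi o : count_trials a (rcons L (pi, o)) =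
  (count_trials a L + (if active a pi then trials a o else 0))%N.
Proof. by rewrite /count_trials big_rcons. Qed.

Lemma count_wins_rcons a L pi o : count_wins a (rcons L (pi, o)) =
  (count_wins a L + (if active a pi then wins a o else 0))%N.
Proof. by rewrite /count_wins big_rcons. Qed.

End Arms.

Section Concentration.
Context {R : realType} {X : problem R}.
Variables (d : demand X) (run : learner X) (a : @arm R X) (q : R) (B : nat).
Hypotheses (hd : demand_in_unit d) (ha : sound d q B a).
Implicit Types (h : seq (outcome X)).

Definition cnt h : nat := count_trials a (log_of run h).
Definition deviation h : R :=
  (count_wins a (log_of run h))%:R - q * (cnt h)%:R.

Section OneSide.
Variables (sgn L : R).
Hypotheses (sgn2 : sgn ^+ 2 = 1) (L0 : 0 <= L).

(* The tilt sqrt (8 L / c) is readjusted as the counter c grows.  The price is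
   that the expectation may increase, but only below the level expR (2 L),
   whereas an excess forces the value expR (4 L): stopping at the first excess,
   i periods give a failure probability of at most (i + 1) expR (- 2 L), however
   large the batches of trials are. *)
Definition tilt h : R :=
  expR (sgn * Num.sqrt (8 * L / (cnt h)%:R) * deviation h).

Definition exceeds h : bool :=
  (0 < cnt h)%N && (Num.sqrt (2 * L * (cnt h)%:R) < sgn * deviation h).

Definition ever_exceeds h : bool :=
  has (fun j => exceeds (take j h)) (iota 0 (size h).+1).

Definition exceeded_before h : bool :=
  has (fun j => exceeds (take j h)) (iota 0 (size h)).

(** Only strict prefixes are inspected. At the first excess the value is still that of [tilt], which
    is at least expR (4 * L), and freezing it at this level afterwards cannot increase it. *)
Definition stopped_tilt h : R :=
  if exceeded_before h then expR (4 * L) else tilt h.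

Lemma ever_exceedsE h : ever_exceeds h = exceeded_before h || exceeds h.
Proof.
rewrite /ever_exceeds -addn1 iotaD has_cat /= add0n orbF take_size.
by congr (_ || _).
Qed.

Lemma exceeded_before_rcons h o : exceeded_before (rcons h o) = ever_exceeds h.
Proof.
rewrite /exceeded_before size_rcons /ever_exceeds; apply: eq_in_has => j.
rewrite mem_iota add0n ltnS => /andP[_ jh].
by rewrite -cats1 takel_cat.
Qed.

Lemma exceeds_tilt h : exceeds h -> expR (4 * L) <= tilt h.
Proof.
case/andP => c0 hs; rewrite /tilt ler_expR.
have c0' : 0 < (cnt h)%:R :> R by rewrite ltr0n.
have -> : 4 * L = Num.sqrt (8 * L / (cnt h)%:R) * Num.sqrt (2 * L * (cnt h)%:R).
  rewrite -sqrtrM; last by rewrite divr_ge0 ?mulr_ge0 ?ler0n.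
  rewrite (_ : 8 * L / _ * _ = (4 * L) ^+ 2); last by field; rewrite gt_eqF.
  by rewrite sqrtr_sqr ger0_norm // mulr_ge0.
have -> (s D : R) : sgn * s * D = s * (sgn * D) by ring.
by rewrite ler_wpM2l ?sqrtr_ge0 // ltW.
Qed.

(** With r = sqrt (c / (c + k)) and y the present exponent, the left side is r y + L (1 - r^2). If y
    >= 2 L, it falls short of y by (1 - r) (y - L (1 + r)) >= 0; otherwise it is at most 2 L - L (1
    - r)^2. *)
Lemma tilt_exponent_step (c k : nat) (D : R) : (0 < c)%N ->
  Num.sqrt (8 * L / (c + k)%:R) * D + L * k%:R / (c + k)%:R <=
  Num.max (Num.sqrt (8 * L / c%:R) * D) (2 * L).
Proof.
move=> c0; have c0' : 0 < c%:R :> R by rewrite ltr0n.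
have ck0 : 0 < (c + k)%:R :> R by rewrite ltr0n addn_gt0 c0.
pose r : R := Num.sqrt (c%:R / (c + k)%:R).
have r2 : r ^+ 2 = c%:R / (c + k)%:R by rewrite sqr_sqrtr // divr_ge0.
have -> : Num.sqrt (8 * L / (c + k)%:R) = r * Num.sqrt (8 * L / c%:R).
  rewrite /r -sqrtrM ?divr_ge0 //; congr Num.sqrt; field.
  by rewrite -natrD !gt_eqF.
have -> : L * k%:R / (c + k)%:R = L * (1 - r ^+ 2).
  rewrite r2; move: ck0; rewrite natrD => ck0; field; by rewrite gt_eqF.
have r0 : 0 <= r by exact: sqrtr_ge0.
have r1 : r <= 1.
  have : r ^+ 2 <= 1 by rewrite r2 ler_pdivrMr // mul1r ler_nat leq_addr.
  by move=> h; rewrite -(@ler_pXn2r _ 2) ?nnegrE ?expr1n.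
set y := Num.sqrt (8 * L / c%:R) * D.
have -> : r * Num.sqrt (8 * L / c%:R) * D = r * y by rewrite /y mulrA.
rewrite le_max; have [hy|hy] := leP (2 * L) y.
  have ? : 0 <= (1 - r) * (y - L * (1 + r)) by have ? := ler_piMr L0 r1; apply: mulr_ge0; lra.
  by apply/orP; left; lra.
have ? := mulr_ge0 L0 (sqr_ge0 (1 - r)).
have ? : r * y <= r * (2 * L) by rewrite ler_wpM2l // ltW.
by apply/orP; right; lra.
Qed.

Lemma expect_tilt h : ((count_wins a (log_of run h)) <= cnt h)%N ->
  expect d (run h) (fun o => tilt (rcons h o)) <= Num.max (tilt h) (expR (2 * L)).
Proof.
case: ha => _ _ _ mgf win_cnt.
have [act|nact] := boolP (active a (run h)); last first.
  rewrite (_ : expect _ _ _ = tilt h) ?le_max ?lexx //.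
  rewrite -[RHS](expect_cst d (run h)); apply: eq_expect => o.
  rewrite /tilt /deviation /cnt log_of_rcons count_trials_rcons count_wins_rcons.
  by rewrite (negPf nact) !addn0.
(* The readjusted tilt depends on the size of the incoming batch, which is random: this is why
   [sound] lets [theta] and [F] depend on the number of trials. *)
pose theta k := sgn * Num.sqrt (8 * L / (cnt h + k)%:R).
have -> : expect d (run h) (fun o => tilt (rcons h o)) =
    expect d (run h) (fun o => expR (theta (trials a o) * deviation h) *
      expR (theta (trials a o) * ((wins a o)%:R - q * (trials a o)%:R))).
  apply: eq_expect => o.
  rewrite /tilt /deviation /cnt log_of_rcons count_trials_rcons count_wins_rcons act.
  rewrite -expRD -mulrDr -/(theta _); congr expR; congr (_ * _).
  by rewrite /cnt !natrD; ring.
apply: le_trans (mgf _ theta (fun k => expR (theta k * deviation h)) act _) _ => [c|].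
  exact: expR_ge0.
rewrite -[leRHS](expect_cst d (run h)); apply: le_expect => // o _.
rewrite -expRD.
(* An empty counter has no deviation, since wins are at most trials, and its first batch raises the
   exponent to at most [L]. *)
have [c0|c0] := posnP (cnt h).
  have D0 : deviation h = 0.
    have := win_cnt; rewrite c0 leqn0 => /eqP w0.
    by rewrite /deviation w0 c0 mulr0 subr0.
  rewrite D0 mulr0 add0r le_max; apply/orP; right; rewrite ler_expR.
  rewrite /theta exprMn sgn2 mul1r c0 add0n.
  rewrite sqr_sqrtr; last by rewrite divr_ge0 ?mulr_ge0 ?ler0n.
  have [->|k0] := posnP (trials a o); first by rewrite mulr0n mulr0 mul0r mulr_ge0.
  have k0' : (trials a o)%:R != 0 :> R by rewrite pnatr_eq0 -lt0n.
  rewrite divfK // mulrC mulrA (_ : 8^-1 * 8 = 1) ?mul1r; last by field.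
  by have ? := L0; lra.
rewrite /tilt.
have -> : theta (trials a o) ^+ 2 * (trials a o)%:R / 8 =
    L * (trials a o)%:R / (cnt h + trials a o)%:R.
  rewrite /theta exprMn sgn2 mul1r sqr_sqrtr; last by rewrite divr_ge0 ?mulr_ge0 ?ler0n.
  by field; rewrite -natrD pnatr_eq0 -lt0n addn_gt0 c0.
have := @tilt_exponent_step (cnt h) (trials a o) (sgn * deviation h) c0.
have -> : theta (trials a o) * deviation h =
    Num.sqrt (8 * L / (cnt h + trials a o)%:R) * (sgn * deviation h).
  by rewrite /theta; ring.
have -> : sgn * Num.sqrt (8 * L / (cnt h)%:R) * deviation h =
    Num.sqrt (8 * L / (cnt h)%:R) * (sgn * deviation h) by ring.
by rewrite !le_max => /orP[] ?; apply/orP; [left|right]; rewrite ler_expR.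
Qed.

Lemma expect_stopped_tilt h : ((count_wins a (log_of run h)) <= cnt h)%N ->
  expect d (run h) (fun o => stopped_tilt (rcons h o)) <=
  stopped_tilt h + expR (2 * L).
Proof.
move=> wc.
under eq_expect do rewrite /stopped_tilt exceeded_before_rcons.
have [ev|nev] := boolP (ever_exceeds h).
  rewrite expect_cst -[leLHS]addr0 lerD ?expR_ge0 //.
  rewrite /stopped_tilt; case: ifP => // nb.
  by apply: exceeds_tilt; move: ev; rewrite ever_exceedsE nb.
apply: le_trans (expect_tilt wc) _.
move: nev; rewrite ever_exceedsE negb_or => /andP[/negPf nb _].
by rewrite /stopped_tilt nb ge_max lerDl lerDr /tilt !expR_ge0.
Qed.

(* The type of outcomes allows add-on purchases without core purchases; they
   have probability zero. *)
Lemma wins_le_trials_invariant h o :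
  (count_wins a (log_of run h) <= cnt h)%N -> outcome_law d (run h) o != 0 ->
  (count_wins a (log_of run (rcons h o)) <= cnt (rcons h o))%N.
Proof.
case: ha => _ _ wt _ hh o0.
rewrite /cnt log_of_rcons count_trials_rcons count_wins_rcons leq_add //.
by case: ifP => // /wt; apply.
Qed.

Lemma hexpect_stopped_tilt i :
  hexpect d run i stopped_tilt <= i.+1%:R * expR (2 * L).
Proof.
elim: i => [|i IH] /=.
  rewrite mul1r /stopped_tilt /= /tilt /deviation /cnt /log_of /count_trials.
  by rewrite /count_wins /= !big_nil !mulr0 subr0 mulr0 ler_expR mulr_ge0.
apply: (le_trans (y := hexpect d run i (fun h => stopped_tilt h + expR (2 * L)))).
  apply: (le_hexpect_inv hd (inv := fun h => (count_wins a (log_of run h) <= cnt h)%N)).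
  - by rewrite /cnt /count_wins /count_trials /= !big_nil.
  - by move=> h o; exact: wins_le_trials_invariant.
  - by move=> h _; exact: expect_stopped_tilt.
by rewrite hexpectD hexpect_cst -[i.+2%:R]natr1 [leRHS]mulrDl
  [1 * expR _]mul1r lerD2r.
Qed.

Lemma hexpect_ever_exceeds i :
  hexpect d run i (fun h => (ever_exceeds h)%:R) <= i.+1%:R * expR (- (2 * L)).
Proof.
have -> : expR (- (2 * L)) = expR (- (4 * L)) * expR (2 * L).
  by rewrite -expRD; congr expR; ring.
rewrite mulrCA; apply: le_trans (ler_wpM2l (expR_ge0 _) (hexpect_stopped_tilt i)).
rewrite -hexpectZ; apply: le_hexpect => // h _.
have [ev|_] := boolP (ever_exceeds h); last first.
  by rewrite mulr_ge0 ?expR_ge0 // /stopped_tilt; case: ifP; rewrite expR_ge0.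
rewrite expRN mulrC ler_pdivlMr ?expR_gt0 // mul1r /stopped_tilt.
case: ifP => // nb; apply: exceeds_tilt.
by move: ev; rewrite ever_exceedsE nb.
Qed.

End OneSide.

Definition misled (L : R) h : bool := ever_exceeds 1 L h || ever_exceeds (-1) L h.

Lemma hexpect_misled L i : 0 <= L ->
  hexpect d run i (fun h => (misled L h)%:R) <= 2 * i.+1%:R * expR (- (2 * L)).
Proof.
move=> L0.
have h1 := @hexpect_ever_exceeds 1 L (expr1n _ _) L0 i.
have h2 := @hexpect_ever_exceeds (-1) L (sqrr_sign R 1) L0 i.
apply: (le_trans (y := hexpect d run i
    (fun h => (ever_exceeds 1 L h)%:R + (ever_exceeds (-1) L h)%:R))).
  apply: le_hexpect => // h _; rewrite /misled -natrD ler_nat.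
  by case: ever_exceeds; case: ever_exceeds.
by rewrite hexpectD; lra.
Qed.

Lemma misledPn L h j : ~~ misled L h -> (j <= size h)%N -> (0 < cnt (take j h))%N ->
  `|deviation (take j h)| <= Num.sqrt (2 * L * (cnt (take j h))%:R).
Proof.
rewrite /misled negb_or => /andP[/hasPn h1 /hasPn h2] jh c0.
have jin : j \in iota 0 (size h).+1 by rewrite mem_iota.
move: (h1 j jin) (h2 j jin); rewrite /exceeds c0 /= mul1r mulN1r -!leNgt => ? ?.
by rewrite ler_norml; apply/andP; split; lra.
Qed.

End Concentration.

(** * The discretized dynamic program *)

(** Lagrangian argument. The multiplier [c] is the positive part of the first gain outside the top
    [S] (0 if there is none). After subtraction of [c] from the positive parts, membership in the
    top set [P] is optimal for each product separately, and the price [c] of the capacity is charged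
    for no more elements of [A] than of [P]. *)
Lemma sum_le_top (R : realType) (M S : nat) (g : 'I_M -> R) (s : 'S_M)
    (A : {set 'I_M}) :
  (forall i j : 'I_M, (i <= j)%N -> g (s j) <= g (s i)) -> (#|A| <= S)%N ->
  \sum_(m in A) g m <= \sum_(m | (0 < g m) && ((s^-1)%g m < S)%N) g m.
Proof.
move=> gs AS.
pose P := [set m | ((s^-1)%g m < S)%N].
pose gp m := Num.max 0 (g m).
have [c [c0 cP cA]] : exists c, [/\ 0 <= c,
    forall m, (m \in A)%:R * (gp m - c) <= (m \in P)%:R * (gp m - c) &
    c * #|A|%:R <= c * #|P|%:R].
  have [SM|MS] := ltnP S M; last first.
    exists 0; split; rewrite ?mul0r // => m; rewrite subr0 ler_wpM2r //.
      by rewrite le_max lexx.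
    by rewrite inE (leq_trans (ltn_ord _) MS) lern1 leq_b1.
  pose c := gp (s (Ordinal SM)); exists c.
  have c0 : 0 <= c by rewrite le_max lexx.
  have Pge m : m \in P -> c <= gp m.
    rewrite inE => mS; rewrite ge_max !le_max lexx /=; apply/orP; right.
    by rewrite -[m](permKV s); apply: gs; exact: ltnW.
  have Ple m : m \notin P -> gp m <= c.
    rewrite inE -leqNgt => mS; rewrite ge_max !le_max lexx /=; apply/orP; right.
    by rewrite -[X in g X <= _](permKV s); exact: gs.
  split => //.
    move=> m; have [mP|mP] := boolP (m \in P).
      by rewrite ler_wpM2r ?subr_ge0 ?Pge // lern1 leq_b1.
    rewrite mul0r mulr_ge0_le0 ?ler0n // subr_le0; exact: Ple.
  rewrite ler_wpM2l // ler_nat (leq_trans AS) //.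
  have -> : P = s @: [set i : 'I_M | (i < S)%N].
    apply/setP => m; apply/idP/imsetP => [mP|[i iS ->]].
      by exists ((s^-1)%g m); rewrite ?permKV // inE; move: mP; rewrite inE.
    by rewrite inE permK; move: iS; rewrite inE.
  rewrite card_imset; last exact: perm_inj.
  have winj : injective (widen_ord (ltnW SM)).
    by move=> i j /(congr1 val) /= ij; exact: val_inj.
  rewrite -[X in (X <= _)%N]card_ord -[X in (X <= _)%N](card_imset _ winj).
  apply: subset_leq_card; apply/subsetP => _ /imsetP[i _ ->].
  by rewrite inE /=.
have split_sum (B : {set 'I_M}) : \sum_(m in B) gp m =
    \sum_m (m \in B)%:R * (gp m - c) + c * #|B|%:R.
  rewrite [X in _ = X + _](_ : _ = \sum_(m in B) (gp m - c)); last first.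
    by rewrite [RHS]big_mkcond; apply: eq_bigr => m _; case: ifP; rewrite ?mul1r ?mul0r.
  by rewrite sumrB sumr_const mulr_natr subrK.
have : \sum_(m in A) g m <= \sum_(m in A) gp m.
  by apply: ler_sum => m _; rewrite le_max lexx orbT.
move/le_trans; apply; rewrite split_sum.
apply: (le_trans (lerD (ler_sum _ (fun m _ => cP m)) cA)); rewrite -split_sum.
rewrite big_mkcond [leRHS]big_mkcond /=; apply: ler_sum => m _.
by rewrite inE andbC /gp; case: ((s^-1)%g m < S)%N.
Qed.

Section PriceBounds.
Context {R : realType} {X : problem R}.
Hypothesis hp : nonneg_prices X.

Lemma max_price_ge0 : 0 <= max_price X.
Proof.
rewrite /max_price; elim/big_rec: _ => // x y _ y0.
by rewrite le_max y0 orbT.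
Qed.

Lemma core_price_bounds (p : core_prices X) : 0 <= val p <= max_price X.
Proof.
have px : val p \in core_prices X by exact: valP.
apply/andP; split; first by apply: hp; rewrite !in_fsetU px.
by apply: (le_bigmax_seq 0 (val p) xpredT id) => //; rewrite in_fsetU px.
Qed.

Lemma supp_price_bounds (p : supp_prices X) : 0 <= val p <= max_price X.
Proof.
have px : val p \in supp_prices X by exact: valP.
apply/andP; split; first by apply: hp; rewrite !in_fsetU px orbT.
by apply: (le_bigmax_seq 0 (val p) xpredT id) => //; rewrite in_fsetU px orbT.
Qed.

Lemma addon_price_ge0 (p : addon_prices X) : 0 <= val p.
Proof. by apply: hp; rewrite !in_fsetU (valP p) orbT. Qed.

End PriceBounds.

Section Revenue.
Context {R : realType} {X : problem R}.
Local Notation N := (ncore X).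
Local Notation M := (nsupp X).
Implicit Types (d : demand X) (pi : policy X).

Definition addon_price pi (m : 'I_M) : R :=
  if m \in selected pi then val (disc_price pi m) else val (supp_price pi m).

(* Weaker than feasibility: an output of the algorithm need not be feasible, the
   discount price of an unselected product being arbitrary. *)
Definition discounts_valid pi : Prop :=
  forall m, m \in selected pi -> val (disc_price pi m) < val (supp_price pi m).

Lemma feasible_discounts_valid pi : feasible pi -> discounts_valid pi.
Proof. by move=> /andP[_ /forallP h] m _. Qed.

Lemma addon_price_bounds pi m : nonneg_prices X -> discounts_valid pi ->
  0 <= addon_price pi m <= max_price X.
Proof.
move=> hp hv; rewrite /addon_price; case: ifP => ms; last exact: supp_price_bounds.
rewrite addon_price_ge0 //= ltW // (lt_le_trans (hv m ms)) //.
by have /andP[] := supp_price_bounds hp (supp_price pi m).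
Qed.

Lemma revenueE d pi : revenue d pi =
  \sum_(n < N) core_rate d n (core_price pi n) * val (core_price pi n)
  + \sum_(m < M) supp_rate d m (supp_price pi m) * val (supp_price pi m)
  + (\sum_(n < N) core_rate d n (core_price pi n)) *
    \sum_(m < M) addon_rate d pi m * addon_price pi m.
Proof.
rewrite /revenue; congr (_ + _ * _); apply: eq_bigr => m _.
by rewrite /addon_rate /addon_price; case: ifP.
Qed.

Lemma addon_rate_in_unit d pi m : demand_in_unit d -> in_unit (addon_rate d pi m).
Proof. by case=> _ _ h1 h2; rewrite /addon_rate; case: ifP. Qed.

End Revenue.

Section DiscretizedDP.
Context {R : realType} {X : problem R}.
Local Notation N := (ncore X).
Local Notation M := (nsupp X).
Variables (d : demand X) (K : nat) (sigma : nat -> 'S_M).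
Variable rnd : 'I_N -> core_prices X -> nat.
Hypotheses (hp : nonneg_prices X) (hd : demand_in_unit d) (K0 : (0 < K)%N).
Hypotheses (hsort : sorts_gains d K sigma) (hrnd : nearest d K rnd).
Implicit Types (pi : policy X).

Let K0' : 0 < K%:R :> R. Proof. by rewrite ltr0n. Qed.

Lemma nearest_error n p : `|core_rate d n p - grid K (rnd n p)| <= K%:R^-1.
Proof.
(* [nearest] compares with every multiple of 1/K; the floor is one at distance at most 1/K. *)
apply: le_trans (hrnd n p (Num.floor (core_rate d n p * K%:R))) _.
have /andP[h1 h2] := floor_itv (core_rate d n p * K%:R).
rewrite -[X in Num.norm (X - _)](@mulfK _ K%:R) ?gt_eqF // -mulrBl normrM.
rewrite (@ger0_norm _ K%:R^-1) ?invr_ge0 ?(ltW K0') //.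
rewrite ler_piMl ?invr_ge0 ?(ltW K0') // ger0_norm ?subr_ge0 //.
by move: h2; rewrite intrD; lra.
Qed.

(** Rounding stays below 1, so the terminal grid point is at most [N * K], the range in which
    [sorts_gains] constrains the order. *)
Lemma nearest_le n p : (rnd n p <= K)%N.
Proof.
rewrite leqNgt; apply/negP => Kr.
have := hrnd n p K%:Z; rewrite /grid -pmulrn divff ?gt_eqF //.
have [/(_ n p)/andP[r0 r1] _ _ _] := hd.
have : 1 < (rnd n p)%:R / K%:R :> R by rewrite ltr_pdivlMr // mul1r ltr_nat.
by move=> h; rewrite ler0_norm ?ler0_norm; lra.
Qed.

Lemma reached_le pi : (reached rnd pi N <= N * K)%N.
Proof.
rewrite /reached -[N in (_ <= N * K)%N]card_ord -sum_nat_const big_mkcond /=.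
by apply: leq_sum => n _; case: ifP => // _; exact: nearest_le.
Qed.

(** The objective that the dynamic program maximizes exactly: the grid point reached replaces the
    total core demand rate in front of the add-on revenue. *)
Definition discretized_revenue pi : R :=
  \sum_(n < N) core_rate d n (core_price pi n) * val (core_price pi n) +
  \sum_(m < M) (if m \in selected pi
     then obj_disc d K (reached rnd pi N) m (supp_price pi m) (disc_price pi m)
     else obj_orig d K (reached rnd pi N) m (supp_price pi m)).

Lemma discretized_revenueE pi : discretized_revenue pi =
  \sum_(n < N) core_rate d n (core_price pi n) * val (core_price pi n) +
  \sum_(m < M) supp_rate d m (supp_price pi m) * val (supp_price pi m) +
  grid K (reached rnd pi N) * \sum_(m < M) addon_rate d pi m * addon_price pi m.
Proof.
rewrite -addrA mulr_sumr -big_split /=; congr (_ + _); apply: eq_bigr => m _.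
by rewrite /obj_disc /obj_orig /addon_rate /addon_price; case: ifP.
Qed.

Lemma grid_reached_error pi :
  `|\sum_(n < N) core_rate d n (core_price pi n) - grid K (reached rnd pi N)| <=
  N%:R / K%:R.
Proof.
rewrite /reached /grid natr_sum mulr_suml.
rewrite [X in _ - X](eq_bigl xpredT) => [|n]; last by rewrite ltn_ord.
rewrite -sumrB (le_trans (ler_norm_sum _ _ _)) //.
apply: (le_trans (ler_sum _ (fun n _ => nearest_error n (core_price pi n)))).
by rewrite sumr_const card_ord mulr_natl.
Qed.

Lemma discretization_error pi : discounts_valid pi ->
  `|revenue d pi - discretized_revenue pi| <=
  N%:R * M%:R * max_price X / K%:R.
Proof.
move=> hv; rewrite revenueE discretized_revenueE.
rewrite opprD addrACA subrr add0r -mulrBl normrM.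
have -> : N%:R * M%:R * max_price X / K%:R =
  N%:R / K%:R * (M%:R * max_price X) by field; rewrite gt_eqF.
apply: ler_pM => //; first exact: grid_reached_error.
have hm m : 0 <= addon_rate d pi m * addon_price pi m <= max_price X.
  have /andP[a0 a1] := addon_rate_in_unit pi m hd.
  have /andP[b0 b1] := addon_price_bounds m hp hv.
  by rewrite mulr_ge0 //= (le_trans _ b1) // ler_piMl.
rewrite ger0_norm; last by apply: sumr_ge0 => m _; case/andP: (hm m).
apply: (le_trans (ler_sum _ (fun m _ => proj2 (andP (hm m))))).
by rewrite sumr_const card_ord mulr_natl.
Qed.

Lemma value_along_ge (p : 'I_N -> core_prices X) (s : seq 'I_N) k :
  \sum_(n <- s) core_rate d n (p n) * val (p n) +
    supp_value d K sigma (k + \sum_(n <- s) rnd n (p n))%N <=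
  value_along d K sigma rnd s k.
Proof.
elim: s k => [|n s IH] k /=; first by rewrite !big_nil add0r addn0.
rewrite !big_cons -addrA addnA.
apply: le_trans (le_bigmax _ _ (p n)).
by rewrite lerD2l.
Qed.

Lemma supp_value_ge pi : feasible pi ->
  \sum_(m < M) (if m \in selected pi
     then obj_disc d K (reached rnd pi N) m (supp_price pi m) (disc_price pi m)
     else obj_orig d K (reached rnd pi N) m (supp_price pi m)) <=
  supp_value d K sigma (reached rnd pi N).
Proof.
move=> /andP[card_sel /forallP hv]; set k := reached rnd pi N.
apply: (le_trans (y := \sum_(m < M) (best_orig d K k m +
    (m \in selected pi)%:R * gain d K k m))).
  apply: ler_sum => m _; case: ifP => _.
    rewrite mul1r /gain addrC subrK /best_disc.
    exact: (le_bigmax_cond _ (fun q => obj_disc d K k m q.1 q.2)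
      (j := (supp_price pi m, disc_price pi m)) (hv m)).
  by rewrite mul0r addr0 /best_orig; exact: le_bigmax.
rewrite /supp_value !big_split /= lerD2l.
have sumE (A : {set 'I_M}) : \sum_(m < M) (m \in A)%:R * gain d K k m =
    \sum_(m in A) gain d K k m.
  by rewrite [RHS]big_mkcond; apply: eq_bigr => m _; case: ifP; rewrite ?mul1r ?mul0r.
rewrite !sumE.
apply: (le_trans (sum_le_top (s := sigma k) _ card_sel)) => [i j ij|].
  by apply: hsort => //; exact: reached_le.
by rewrite le_eqVlt; apply/orP; left; apply/eqP; apply: eq_bigl => m; rewrite inE.
Qed.

Lemma discretized_revenue_le pi : feasible pi ->
  discretized_revenue pi <= value d K sigma rnd 0 0.
Proof.
move=> hf; rewrite /value drop0.
apply: le_trans (value_along_ge (core_price pi) _ _).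
rewrite big_enum lerD2l big_enum add0n.
apply: le_trans (supp_value_ge hf) _.
by rewrite le_eqVlt; apply/orP; left; apply/eqP; congr supp_value;
  apply: eq_bigl => n; rewrite ltn_ord.
Qed.

Lemma core_optimal_value pi j : core_optimal d K sigma rnd pi -> (j <= N)%N ->
  value d K sigma rnd 0 0 =
  \sum_(n < N | (n < j)%N) core_rate d n (core_price pi n) * val (core_price pi n) +
  value d K sigma rnd j (reached rnd pi j).
Proof.
move=> opt; elim: j => [|j IH] jN.
  by rewrite /reached !big_pred0_eq add0r.
rewrite (IH (ltnW jN)); pose i := Ordinal jN.
have ltS (n : 'I_N) : (n < j.+1)%N && (n != i) = (n < j)%N.
  by rewrite ltnS -val_eqE /= ltn_neqAle andbC.
have -> : reached rnd pi j.+1 = (reached rnd pi j + rnd i (core_price pi i))%N.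
  rewrite /reached (bigD1 i) //= addnC; congr (_ + _)%N; exact: eq_bigl.
rewrite -(opt i) /= [in RHS](bigD1 i) //= (eq_bigl _ _ ltS).
by rewrite addrA [X in X + _]addrC.
Qed.

Lemma ddp_discretized_revenue pi : core_optimal d K sigma rnd pi ->
  supp_optimal d K sigma rnd pi ->
  discretized_revenue pi = value d K sigma rnd 0 0.
Proof.
move=> copt [sel_pi sopt]; rewrite (core_optimal_value copt (leqnn N)).
rewrite /discretized_revenue [X in _ = X + _](eq_bigl xpredT) => [|n]; last exact: ltn_ord.
congr (_ + _); rewrite /value drop_oversize ?size_enum_ord //=.
apply: eq_bigr => m _; have := sopt m; rewrite -sel_pi; case: ifP => _.
  by case=> _ ->; rewrite mul1r /gain addrC subrK.
by move=> ->; rewrite mul0r addr0.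
Qed.

End DiscretizedDP.

Lemma ddp_output_discounts_valid (R : realType) (X : problem R) (d : demand X)
  (K : nat) (pi : policy X) : ddp_output d K pi -> discounts_valid pi.
Proof.
by move=> [sigma [rnd [_ _ _ [_ opt]]]] m ms; have := opt m; rewrite ms => -[].
Qed.

(** The discretization error is paid once for each of the two policies. *)
Lemma ddp_output_near_optimal (R : realType) (X : problem R) (d : demand X)
    (K : nat) (pi pi' : policy X) :
  nonneg_prices X -> demand_in_unit d -> (0 < K)%N ->
  ddp_output d K pi -> feasible pi' ->
  revenue d pi' <=
    revenue d pi + 2 * ((ncore X)%:R * (nsupp X)%:R * max_price X / K%:R).
Proof.
move=> hp hd K0 out hf; have hv := ddp_output_discounts_valid out.
case: out => sigma [rnd [hs hr copt sopt]].
have e1 := discretization_error hp hd K0 hr hv.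
have e2 := discretization_error hp hd K0 hr (feasible_discounts_valid hf).
have := discretized_revenue_le hd K0 hs hr hf.
rewrite -(ddp_discretized_revenue copt sopt).
by move: e1 e2; rewrite !ler_norml => /andP[? ?] /andP[? ?] ?; lra.
Qed.

(** * Episodes *)

Section Episodes.
Context {R : realType} {X : problem R}.
Variables (run : @learner R X).
Implicit Types (h : seq (outcome X)).

Lemma episode_start_le h j : (episode_start run h j <= j)%N.
Proof. by elim: j => //= j IH; case: ifP => // _; exact: leqW. Qed.

Lemma episode_start_take h k j : (j <= k)%N ->
  episode_start run (take k h) j = episode_start run h j.
Proof.
elim: j => //= j IH jk; rewrite (IH (ltnW jk)).
have sk : (episode_start run h j <= k)%N.
  by rewrite (leq_trans (episode_start_le h j)) // ltnW.
by rewrite !take_takel // ltnW.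
Qed.

Lemma episode_start_between h i j : (episode_start run h j <= i <= j)%N ->
  episode_start run h i = episode_start run h j.
Proof.
elim: j => [|j IH]; first by rewrite /= leqn0 => /eqP ->.
case/andP=> si; rewrite leq_eqVlt => /orP[/eqP -> //|ij].
move: si => /=; case: ifP => _ si; last by apply: IH; rewrite si -ltnS.
by move: ij; rewrite ltnNge si.
Qed.

Lemma episode_not_ended h j : (episode_start run h j < j)%N ->
  ~~ episode_ends (run (take (episode_start run h j) h))
       (log_of run (take (episode_start run h j) h))
       (log_of run (take j h)).
Proof.
case: j => //= j; case: ifP => [_|/negbT //]; rewrite ?ltnn //.
Qed.


Variable eps : R.
Hypothesis hrun : ucb_add_on eps run.
Hypothesis N0 : (0 < ncore X)%N.

Lemma episode_policy h j : (j <= size h)%N ->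
  run (take j h) = run (take (episode_start run h j) h).
Proof.
move=> jh; have := hrun (take j h); rewrite size_takel // episode_start_take //=.
case: ifP => [/eqP -> //|_ ->].
by rewrite take_takel ?episode_start_le.
Qed.

Lemma episode_policy_output h j : (j <= size h)%N ->
  let g := take (episode_start run h j) h in
  ddp_output (ucb_demand (size g).+1 (log_of run g))
    (grid_size eps (size g).+1) (run g).
Proof.
move=> jh g; have sj := episode_start_le h j.
have sg : size g = episode_start run h j by rewrite size_takel // (leq_trans sj).
have := hrun g; rewrite sg {1 2}/g episode_start_take //.
by rewrite (episode_start_between (h := h) (j := j)) ?leqnn ?sj //= eqxx.
Qed.

Lemma take_succ_rcons h i : (i < size h)%N ->
  exists o, take i.+1 h = rcons (take i h) o.
Proof. by case: h => // o h ih; exists (nth o (o :: h) i); rewrite -take_nth. Qed.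

Lemma core_count_le h n p :
  (count_trials (core_arm n p) (log_of run h) <= size h)%N.
Proof.
elim/last_ind: h => [|h o IH]; first by rewrite /count_trials big_nil.
rewrite log_of_rcons count_trials_rcons size_rcons -addn1 leq_add //=.
by case: ifP.
Qed.

(* The counter of a core price in use grows by one in every period, so the
   doubling rule bounds the length of an episode by its starting time. *)
Lemma episode_start_half h : (size h <= (episode_start run h (size h)).*2)%N.
Proof.
set s := episode_start run h (size h).
have sj : (s <= size h)%N := episode_start_le h (size h).
move: sj; rewrite leq_eqVlt => /orP[/eqP e|sj].
  by rewrite -addnn -{1}e leq_addl.
pose pi := run (take s h); pose n : 'I_(ncore X) := Ordinal N0.
pose c g := count_trials (core_arm n (core_price pi n)) (log_of run g).
have cstep k : (s + k <= size h)%N -> c (take (s + k) h) = (c (take s h) + k)%N.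
  elim: k => [|k IH] sk; first by rewrite !addn0.
  rewrite addnS in sk *.
  have [o ->] := take_succ_rcons sk.
  rewrite /c log_of_rcons count_trials_rcons /=.
  have -> : run (take (s + k) h) = pi.
    rewrite episode_policy ?(ltnW sk) //.
    by rewrite (episode_start_between (h := h) (j := size h)) ?leq_addr ?(ltnW sk).
  by rewrite eqxx -/(c _) (IH (ltnW sk)) -addnA addn1.
have ck := cstep (size h - s)%N; rewrite subnKC ?(ltnW sj) // in ck.
have c0 : (c (take s h) <= s)%N.
  by rewrite (leq_trans (core_count_le _ _ _)) // size_take_min geq_minl.
have := episode_not_ended sj; rewrite negb_or => /andP[/existsPn /(_ n) nd _].
have : ~~ doubled (c (take s h)) (c (take (size h) h)) := nd.
by rewrite /doubled (ck (leqnn _)); lia.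
Qed.

End Episodes.

(** * Confidence bounds *)

Section Logarithms.
Context {R : realType}.

Lemma ln2_ge : 1 / 2 <= ln 2 :> R.
Proof.
rewrite -ler_expR lnK ?posrE //.
have h := expR_ge1Dx (- (1 / 2) : R).
have e0 := expR_gt0 (1 / 2 : R).
have e : expR (1 / 2 : R) * expR (- (1 / 2)) = 1 by rewrite expRN divff ?gt_eqF.
by nra.
Qed.

Lemma ln_natS_ge0 n : 0 <= ln n.+1%:R :> R.
Proof. by apply: ln_ge0; rewrite ler1n. Qed.

Lemma invS_le_ln n : n.+2%:R^-1 <= ln n.+2%:R - ln n.+1%:R :> R.
Proof.
have e : ln (n.+1%:R / n.+2%:R) = ln n.+1%:R - ln n.+2%:R :> R.
  by rewrite ln_div ?posrE ?ltr0n.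
have h : ln (n.+1%:R / n.+2%:R) <= - n.+2%:R^-1 :> R.
  rewrite -ler_expR lnK ?posrE ?divr_gt0 ?ltr0n //.
  apply: le_trans (expR_ge1Dx _).
  rewrite le_eqVlt; apply/orP; left; apply/eqP.
  rewrite -[n.+2%:R]natr1; have := ltr0Sn R n.
  by move: n.+1%:R => x x0; field; lra.
by move: h; rewrite e -[X in _ -> _ <= X]opprB lerNr.
Qed.

Lemma sum_inv_le_ln T : \sum_(i < T) i.+2%:R^-1 <= ln T.+1%:R :> R.
Proof.
elim: T => [|T IH]; first by rewrite big_ord0 ln1.
by rewrite big_ord_recr /= (le_trans (lerD IH (invS_le_ln T))) // addrC subrK.
Qed.

Lemma sum_inv_sqrt_le T :
  \sum_(i < T) (Num.sqrt i.+2%:R)^-1 <= 2 * Num.sqrt T%:R :> R.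
Proof.
elim: T => [|T IH]; first by rewrite big_ord0 sqrtr0 mulr0.
rewrite big_ord_recr /=.
have key (x y : R) : 0 < y -> y ^+ 2 = x ^+ 2 + 1 -> y^-1 <= 2 * (y - x).
  move=> y0 e; rewrite -[X in X <= _]mul1r ler_pdivrMr //.
  by have := sqr_ge0 (y - x); move: e; rewrite !expr2; lra.
have s1 : 0 < Num.sqrt T.+1%:R :> R by rewrite sqrtr_gt0 ltr0n.
have h : (Num.sqrt T.+2%:R)^-1 <= (Num.sqrt T.+1%:R)^-1 :> R.
  by rewrite lef_pV2 ?posrE ?sqrtr_gt0 ?ltr0n // ler_sqrt ?ltr0n // ler_nat.
have := key (Num.sqrt T%:R) _ s1.
rewrite !sqr_sqrtr ?ler0n // natr1 => /(_ erefl) h'.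
apply: le_trans (lerD IH (le_trans h h')) _.
by rewrite mulrBr addrC subrK.
Qed.

(** Cauchy-Schwarz, obtained from AM-GM for each pair of terms of the squared sum. *)
Lemma sum_sqrt_le (I : finType) (c : I -> R) (U S : R) : (forall i, 0 <= c i) ->
  #|I|%:R <= U -> \sum_i c i <= S -> \sum_i Num.sqrt (c i) <= Num.sqrt (U * S).
Proof.
move=> c0 IU cS.
have s0 : 0 <= \sum_i Num.sqrt (c i) by apply: sumr_ge0 => i _; exact: sqrtr_ge0.
rewrite -[leLHS]ger0_norm // -sqrtr_sqr ler_wsqrtr //.
have sc0 : 0 <= \sum_i c i by apply: sumr_ge0.
apply: (le_trans (y := #|I|%:R * \sum_i c i)); last by rewrite ler_pM ?ler0n.
rewrite expr2 mulr_suml.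
under eq_bigr do rewrite mulr_sumr.
apply: (le_trans (y := \sum_i \sum_j (c i / 2 + c j / 2))).
  apply: ler_sum => i _; apply: ler_sum => j _.
  have := sqr_ge0 (Num.sqrt (c i) - Num.sqrt (c j)).
  rewrite sqrrB !sqr_sqrtr //; lra.
rewrite le_eqVlt; apply/orP; left; apply/eqP.
transitivity (\sum_i (#|I|%:R / 2 * c i + (\sum_j c j) / 2)).
  apply: eq_bigr => i _; rewrite big_split sumr_const /= -mulr_suml; congr (_ + _).
  by rewrite -[LHS]mulr_natl; field.
rewrite big_split -mulr_sumr sumr_const /= -[_ *+ _]mulr_natl.
by field.
Qed.

End Logarithms.

Section ConfidenceBounds.
Context {R : realType} {X : problem R}.
Variables (d : demand X) (eps : R) (run : @learner R X).
Hypotheses (hd : demand_in_unit d) (hrun : ucb_add_on eps run) (N0 : (0 < ncore X)%N).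
Implicit Types (h : seq (outcome X)) (a : @arm R X).

(** The data from which the policy now in use was computed. *)
Definition epoch h : seq (outcome X) := take (episode_start run h (size h)) h.

Definition arm_ucb a h : R :=
  ucb (size (epoch h)).+1 (count_wins a (log_of run (epoch h))) (cnt run a (epoch h)).

(* The level is a lower bound, depending on the current time only, of the
   logarithm used at the start of the current episode. *)
Definition fail q a h : bool := misled run a q (ln ((size h).+2%:R / 2)) h.

(** Bounds the overestimation by the present counter instead of the one at the start of the episode.
    The factor 4 is 2 * 2: the error of the average and the added radius are both at most sqrt (2 l
    / c0), and c <= 2 c0 makes this at most 2 sqrt (l / c). *)
Definition bonus (l : R) (c : nat) : R :=
  if c == 0%N then 1 else Num.min 1 (4 * Num.sqrt (l / c%:R)).

(** In particular a counter that is positive now was positive when the estimate was formed, so the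
    estimate is not the default 1. *)
Definition undoubled a h : Prop :=
  (cnt run a (epoch h) < cnt run a h -> cnt run a h < (cnt run a (epoch h)).*2)%N.

Lemma ucb_in_unit t w c : in_unit (@ucb R t w c).
Proof.
rewrite /in_unit /ucb; case: eqP => _; first by rewrite ler01 lexx.
by rewrite le_min ler01 addr_ge0 ?divr_ge0 ?sqrtr_ge0 //= ge_min lexx.
Qed.

Lemma size_epoch h : size (epoch h) = episode_start run h (size h).
Proof. by rewrite size_takel // episode_start_le. Qed.

Lemma half_le_epoch h : (size h).+2%:R / 2 <= (size (epoch h)).+1%:R :> R.
Proof.
have := episode_start_half hrun N0 h; rewrite -size_epoch => sh.
rewrite ler_pdivrMr // -natrM ler_nat; lia.
Qed.

Lemma fail_log_le h : ln ((size h).+2%:R / 2) <= ln (size (epoch h)).+1%:R :> R.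
Proof. by rewrite ler_ln ?posrE ?divr_gt0 ?ltr0n ?half_le_epoch. Qed.

Lemma bonus_ge0 l c : 0 <= bonus l c.
Proof.
by rewrite /bonus; case: eqP => // _; rewrite le_min ler01 mulr_ge0 ?sqrtr_ge0.
Qed.

Lemma bonus_le1 l c : bonus l c <= 1.
Proof. by rewrite /bonus; case: eqP => // _; rewrite ge_min lexx. Qed.

(** The start of the episode is random, but [misled] inspects every prefix of the history and hence
    also [epoch h]. *)
Lemma estimate_error q a h : ~~ fail q a h -> (0 < cnt run a (epoch h))%N ->
  `|(count_wins a (log_of run (epoch h)))%:R / (cnt run a (epoch h))%:R - q| <=
  Num.sqrt (2 * ln (size (epoch h)).+1%:R / (cnt run a (epoch h))%:R).
Proof.
move=> nf c0; have c0' : 0 < (cnt run a (epoch h))%:R :> R by rewrite ltr0n.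
have := misledPn nf (episode_start_le run h (size h)) c0.
rewrite -/(epoch h) /deviation => dev.
set c := (cnt run a (epoch h))%:R in c0' dev *.
have -> : (count_wins a (log_of run (epoch h)))%:R / c - q =
    ((count_wins a (log_of run (epoch h)))%:R - q * c) / c.
  by field; rewrite gt_eqF.
rewrite normrM normfV (gtr0_norm c0') ler_pdivrMr //; apply: le_trans dev _.
have -> : Num.sqrt (2 * ln (size (epoch h)).+1%:R / c) * c =
    Num.sqrt (2 * ln (size (epoch h)).+1%:R * c).
  rewrite -{2}(ger0_norm (ltW c0')) -sqrtr_sqr -sqrtrM.
    by congr Num.sqrt; field; rewrite gt_eqF.
  by rewrite divr_ge0 ?mulr_ge0 ?ln_natS_ge0 // ltW.
by rewrite ler_wsqrtr // ler_wpM2r ?(ltW c0') // ler_wpM2l // fail_log_le.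
Qed.

Lemma arm_ucb_ge q a h : in_unit q -> q - arm_ucb a h <= (fail q a h)%:R.
Proof.
move=> /andP[q0 q1]; have /andP[u0 u1] : in_unit (arm_ucb a h) := ucb_in_unit _ _ _.
have [_|nf] := boolP (fail q a h); first by rewrite /=; lra.
rewrite subr_le0 /arm_ucb /ucb; case: eqP => [//|/eqP]; rewrite -lt0n => c0.
rewrite le_min q1 /=.
by have := estimate_error nf c0; rewrite ler_norml => /andP[? ?]; lra.
Qed.

Lemma arm_ucb_le q a h T : in_unit q -> (size h < T)%N -> undoubled a h ->
  arm_ucb a h - q <= (fail q a h)%:R + bonus (ln T%:R) (cnt run a h).
Proof.
move=> /andP[q0 q1] hT und; have /andP[u0 u1] : in_unit (arm_ucb a h) := ucb_in_unit _ _ _.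
have b0 := bonus_ge0 (ln T%:R) (cnt run a h).
have [_|nf] := boolP (fail q a h); first by rewrite /=; lra.
rewrite add0r /bonus; case: eqP => [_|/eqP c0]; first lra.
rewrite -lt0n in c0.
have ce0 : (0 < cnt run a (epoch h))%N by move: und; rewrite /undoubled; lia.
rewrite le_min; apply/andP; split; first lra.
have cc : (cnt run a h <= 2 * cnt run a (epoch h))%N.
  by move: und; rewrite /undoubled; lia.
have lnT : ln (size (epoch h)).+1%:R <= ln T%:R :> R.
  rewrite ler_ln ?posrE ?ltr0n ?(leq_ltn_trans _ hT) // ler_nat.
  by rewrite (leq_trans _ hT) // ltnS size_epoch episode_start_le.
have rad : Num.sqrt (2 * ln (size (epoch h)).+1%:R / (cnt run a (epoch h))%:R) <=
    2 * Num.sqrt (ln T%:R / (cnt run a h)%:R) :> R.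
  have e2 : 2 = Num.sqrt 4 :> R.
    by rewrite (_ : 4 = 2 ^+ 2 :> R) ?sqrtr_sqr ?ger0_norm //; ring.
  rewrite [X in _ <= X * _]e2.
  rewrite -sqrtrM // ler_wsqrtr //.
  have p1 : 0 < (cnt run a (epoch h))%:R :> R by rewrite ltr0n.
  have p2 : 0 < (cnt run a h)%:R :> R by rewrite ltr0n.
  rewrite mulrA ler_pdivrMr // mulrAC ler_pdivlMr //.
  have l0 : 0 <= ln (size (epoch h)).+1%:R :> R := ln_natS_ge0 _.
  have cc' : (cnt run a h)%:R <= 2 * (cnt run a (epoch h))%:R :> R.
    by rewrite -natrM ler_nat.
  have := ler_pM l0 (ltW p2) lnT cc'; lra.
have := estimate_error nf ce0; rewrite ler_norml => /andP[_ e].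
rewrite /arm_ucb /ucb; case: eqP => [ce|_]; first by rewrite ce in ce0.
by rewrite lerBlDl ge_min; apply/orP; right; lra.
Qed.

(** At the level ln ((i + 2) / 2) the exponential is 4 / (i + 2)^2; the number of periods cancels
    one of the two factors, and the bounds sum like a harmonic series. *)
Lemma hexpect_fail q B a i : sound d q B a ->
  hexpect d run i (fun h => (fail q a h)%:R) <= 8 / i.+2%:R.
Proof.
move=> ha; have i0 : 0 < i.+2%:R :> R by rewrite ltr0n.
rewrite (@eq_hexpect _ _ d run i _
  (fun h => (misled run a q (ln (i.+2%:R / 2)) h)%:R)); last first.
  by move=> h hi; rewrite /fail hi.
have L0 : 0 <= ln (i.+2%:R / 2) :> R.
  by apply: ln_ge0; rewrite ler_pdivlMr // mul1r ler_nat.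
apply: (le_trans (hexpect_misled run hd ha i L0)).
have -> : expR (- (2 * ln (i.+2%:R / 2))) = (2 / i.+2%:R) ^+ 2 :> R.
  rewrite expRN expRM_natl lnK ?posrE ?divr_gt0 //.
  by rewrite -exprVn invf_div.
have le1 : i.+1%:R / i.+2%:R <= 1 :> R by rewrite ler_pdivrMr // mul1r ler_nat.
have -> : 2 * i.+1%:R * (2 / i.+2%:R) ^+ 2 = 8 / i.+2%:R * (i.+1%:R / i.+2%:R) :> R.
  by move: i.+1%:R i.+2%:R i0 => x y y0; field; rewrite gt_eqF.
by rewrite ler_piMr // divr_ge0 ?ler0n.
Qed.

Definition addon_arm (pi : policy X) (m : 'I_(nsupp X)) : @arm R X :=
  if m \in selected pi then disc_arm m (disc_price pi m)
  else orig_arm m (supp_price pi m).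

Lemma undoubledP a h :
  ((episode_start run h (size h) < size h)%N ->
     ~~ doubled (cnt run a (epoch h)) (cnt run a h)) -> undoubled a h.
Proof.
rewrite /undoubled; have := episode_start_le run h (size h).
rewrite leq_eqVlt => /orP[/eqP e _|sh /(_ sh)]; last by rewrite /doubled; lia.
by rewrite /epoch e take_size ltnn.
Qed.

Lemma run_epoch h : run h = run (epoch h).
Proof. by rewrite -[in LHS](take_size h) (episode_policy hrun). Qed.

Lemma core_undoubled h n : undoubled (core_arm n (core_price (run h) n)) h.
Proof.
apply: undoubledP => /episode_not_ended; rewrite negb_or take_size => /andP[nd _].
by move/existsPn: nd => /(_ n); rewrite -/(epoch h) -run_epoch.
Qed.

Lemma supp_undoubled h m : undoubled (supp_arm m (supp_price (run h) m)) h.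
Proof.
apply: undoubledP => /episode_not_ended; rewrite negb_or take_size => /andP[_ nd].
by move/existsPn: nd => /(_ m); rewrite negb_or -/(epoch h) -run_epoch => /andP[].
Qed.

Lemma addon_undoubled h m : undoubled (addon_arm (run h) m) h.
Proof.
apply: undoubledP => /episode_not_ended; rewrite negb_or take_size => /andP[_ nd].
move/existsPn: nd => /(_ m); rewrite negb_or -/(epoch h) -run_epoch => /andP[_].
by rewrite /addon_arm; case: ifP.
Qed.

End ConfidenceBounds.

(** * Summing the confidence radii *)

Section Potential.
Context {R : realType}.

(* The first term pays for the periods in which the counter is below B, where a
   batch of trials may exceed the counter itself. *)
Definition potential (l : R) (B c : nat) : R :=
  (minn c B.*2)%:R + 10 * Num.sqrt l * Num.sqrt c%:R.

(** If c < B, then c + k < 2 B and the first term grows by [k], which suffices as a bonus is at most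
    1. If c >= B, then k <= c, so with a = sqrt c and b = sqrt (c + k) one has b <= 3/2 a and k = (b
    - a) (b + a) <= 5/2 a (b - a). The constant 10 of the potential is 5/2 times the 4 of the
    bonus. *)
Lemma bonus_potential (l : R) (B c k : nat) : 0 <= l -> (k <= B)%N ->
  potential l B c + k%:R * bonus l c <= potential l B (c + k).
Proof.
move=> l0 kB; have [->|k0] := posnP k; first by rewrite mul0r addr0 addn0.
have sl0 : 0 <= Num.sqrt l by exact: sqrtr_ge0.
have sle : Num.sqrt c%:R <= Num.sqrt (c + k)%:R :> R.
  by rewrite ler_wsqrtr // ler_nat leq_addr.
have [cB|Bc] := ltnP c B.
  have -> : potential l B (c + k) = c%:R + k%:R + 10 * Num.sqrt l * Num.sqrt (c + k)%:R.
    by rewrite /potential -natrD (minn_idPl _) //; lia.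
  rewrite /potential (minn_idPl _); last by lia.
  rewrite addrAC lerD ?lerD2l //; last by rewrite ler_wpM2l ?mulr_ge0.
  by rewrite ler_piMr ?bonus_le1.
have c0 : (0 < c)%N by lia.
rewrite /potential -addrA; apply: lerD; first by rewrite ler_nat; lia.
have b4 : bonus l c <= 4 * (Num.sqrt l / Num.sqrt c%:R).
  rewrite /bonus (gtn_eqF c0) ge_min; apply/orP; right.
  by rewrite sqrtrM // sqrtrV.
set a := Num.sqrt c%:R in sle b4 *; set b := Num.sqrt (c + k)%:R in sle *.
have a0 : 0 < a by rewrite sqrtr_gt0 ltr0n.
have a2 : a ^+ 2 = c%:R by rewrite sqr_sqrtr.
have b2 : b ^+ 2 = a ^+ 2 + k%:R by rewrite sqr_sqrtr // natrD a2.
have k2 : k%:R <= a ^+ 2 by rewrite a2 ler_nat (leq_trans kB).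
have ba : 2 * b <= 3 * a.
  rewrite -(@ler_pXn2r _ 2) ?nnegrE ?mulr_ge0 ?(ltW a0) ?sqrtr_ge0 //.
  by rewrite !exprMn b2; have := sqr_ge0 a; lra.
have kle : k%:R <= 5 / 2 * a * (b - a).
  have -> : k%:R = (b - a) * (b + a) by rewrite -[LHS](addKr (a ^+ 2)) -b2; ring.
  by rewrite mulrC ler_wpM2r ?subr_ge0 //; lra.
apply: (le_trans (lerD (lexx _) (ler_wpM2l (ler0n _ k) b4))).
have -> : 10 * Num.sqrt l * b = 10 * Num.sqrt l * a +
   5 / 2 * a * (b - a) * (4 * (Num.sqrt l / a)) by field; rewrite gt_eqF.
by rewrite lerD2l ler_wpM2r // mulr_ge0 // divr_ge0 // ltW.
Qed.

End Potential.

Section Exposure.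
Context {R : realType} {X : problem R}.
Variables (d : demand X) (run : @learner R X).
Hypothesis hd : demand_in_unit d.
Implicit Types (h : seq (outcome X)) (a : @arm R X).

(** The conditional mean of the next increment of the counter, which is also the weight that the
    error of an arm in use receives in the revenue bound. *)
Definition exposure a h : R :=
  (active a (run h))%:R * expect d (run h) (fun o => (trials a o)%:R).

Lemma exposure_ge0 a h : 0 <= exposure a h.
Proof.
rewrite mulr_ge0 ?ler0n // sumr_ge0 // => o _.
by rewrite mulr_ge0 ?ler0n ?outcome_law_ge0.
Qed.

Lemma cnt_rcons a h o : cnt run a (rcons h o) =
  (cnt run a h + (if active a (run h) then trials a o else 0))%N.
Proof. by rewrite /cnt log_of_rcons count_trials_rcons. Qed.

Lemma hexpect_bonus_step q B a l i : sound d q B a -> 0 <= l ->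
  hexpect d run i (fun h => potential l B (cnt run a h)) +
  hexpect d run i (fun h => exposure a h * bonus l (cnt run a h)) <=
  hexpect d run i.+1 (fun h => potential l B (cnt run a h)).
Proof.
case=> _ tB _ _ l0; rewrite -hexpectD /=; apply: le_hexpect => // h _.
rewrite /exposure; have [act|nact] := boolP (active a (run h)); last first.
  rewrite !mul0r addr0 -[leLHS](expect_cst d (run h)); apply: le_expect => // o _.
  by rewrite cnt_rcons (negPf nact) addn0.
rewrite mul1r mulrC -expectZ -[X in X + _](expect_cst d (run h)) -expectD.
apply: le_expect => // o _; rewrite cnt_rcons act.
by rewrite [bonus _ _ * _]mulrC bonus_potential.
Qed.

Lemma sum_hexpect_bonus q B a l T : sound d q B a -> 0 <= l ->
  \sum_(i < T) hexpect d run i (fun h => exposure a h * bonus l (cnt run a h)) <=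
  hexpect d run T (fun h => potential l B (cnt run a h)).
Proof.
move=> ha l0; elim: T => [|T IH].
  by rewrite big_ord0 /= addr_ge0 ?ler0n ?mulr_ge0 ?sqrtr_ge0.
rewrite big_ord_recr /=; apply: le_trans (hexpect_bonus_step T ha l0).
by rewrite lerD2r.
Qed.

Lemma family_cnt_le (P : finType) (A : P -> arm) B h :
  (forall p o, (trials (A p) o <= B)%N) ->
  (forall pi, (\sum_p active (A p) pi <= 1)%N) ->
  (\sum_p cnt run (A p) h <= B * size h)%N.
Proof.
move=> tB dis; elim/last_ind: h => [|h o IH].
  by rewrite muln0 leqn0 sum_nat_eq0; apply/forallP => p; rewrite /cnt /count_trials big_nil.
under eq_bigr do rewrite cnt_rcons.
rewrite big_split size_rcons mulnS addnC /=; apply: leq_add => //.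
rewrite -[X in (_ <= X)%N]muln1; apply: leq_trans (leq_mul (leqnn B) (dis (run h))).
by rewrite big_distrr /=; apply: leq_sum => p _; case: ifP; rewrite ?muln1 ?tB ?muln0.
Qed.

(** The arms of a family are the prices of one product. At most one is active in a period, so their
    counters share a budget of [B * T] trials, and Cauchy-Schwarz over the prices gives the square
    root of U T. *)
Lemma family_bonus (P : finType) (A : P -> arm) (q : P -> R) (B T : nat) (U l : R) :
  (forall p, sound d (q p) B (A p)) ->
  (forall pi, (\sum_p active (A p) pi <= 1)%N) ->
  #|P|%:R <= U -> 0 <= l ->
  \sum_(i < T) hexpect d run i
    (fun h => \sum_p exposure (A p) h * bonus l (cnt run (A p) h)) <=
  2 * B%:R * U + 10 * Num.sqrt l * Num.sqrt (U * (B * T)%:R).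
Proof.
move=> hA dis PU l0.
under eq_bigr do rewrite hexpect_sum.
rewrite exchange_big /=.
apply: (le_trans (ler_sum _ (fun p _ => sum_hexpect_bonus T (hA p) l0))).
rewrite -hexpect_sum -[leRHS](hexpect_cst d run T); apply: le_hexpect => // h hT.
rewrite /potential big_split /= -mulr_sumr; apply: lerD.
  apply: (le_trans (y := \sum_(p : P) (2 * B%:R))).
    by apply: ler_sum => p _; rewrite -natrM mul2n ler_nat geq_minr.
  by rewrite sumr_const -[leLHS]mulr_natr ler_wpM2l // mulr_ge0.
rewrite ler_wpM2l ?mulr_ge0 ?sqrtr_ge0 //; apply: sum_sqrt_le => //.
rewrite -natr_sum ler_nat -hT; apply: family_cnt_le => // p o.
by case: (hA p).
Qed.

End Exposure.

(** * Sensitivity of the revenue to the demand rates *)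

Section Decomposition.
Context {R : realType} {X : problem R}.
Local Notation N := (ncore X).
Local Notation M := (nsupp X).
Hypothesis hp : nonneg_prices X.

Lemma sum_rate_price_bounds (I : finType) (r v : I -> R) (P : R) :
  (forall i, in_unit (r i)) -> (forall i, 0 <= v i <= P) ->
  0 <= \sum_i r i * v i <= #|I|%:R * P.
Proof.
move=> r01 vP; have b i : 0 <= r i * v i <= P.
  have /andP[r0 r1] := r01 i; have /andP[v0 v1] := vP i.
  by rewrite mulr_ge0 //= (le_trans _ v1) // ler_piMl.
apply/andP; split; first by apply: sumr_ge0 => i _; case/andP: (b i).
apply: (le_trans (ler_sum _ (fun i _ => proj2 (andP (b i))))).
by rewrite sumr_const mulr_natl.
Qed.

Lemma sum_rate_diff (I : finType) (r1 r2 v e : I -> R) (P : R) :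
  (forall i, 0 <= v i <= P) -> (forall i, 0 <= e i) ->
  (forall i, r1 i - r2 i <= e i) ->
  \sum_i r1 i * v i - \sum_i r2 i * v i <= P * \sum_i e i.
Proof.
move=> vP e0 re; rewrite -sumrB mulr_sumr; apply: ler_sum => i _.
have /andP[v0 v1] := vP i; rewrite -mulrBl.
by apply: (le_trans (ler_wpM2r v0 (re i))); rewrite mulrC ler_wpM2r.
Qed.

(** With G the total core demand rate and A the add-on revenue, G1 A1 - G2 A2 = (G1 - G2) A1 + G2
    (A1 - A2). The bound M P on A1 gives the factor 1 + M of the core errors, and the add-on errors
    are weighted by the core demand of [d2]. *)
Lemma revenue_diff (d1 d2 : demand X) (pi : policy X)
    (e : 'I_N -> R) (f g : 'I_M -> R) :
  demand_in_unit d1 -> demand_in_unit d2 -> discounts_valid pi ->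
  (forall n, 0 <= e n) -> (forall m, 0 <= f m) -> (forall m, 0 <= g m) ->
  (forall n, core_rate d1 n (core_price pi n) - core_rate d2 n (core_price pi n) <= e n) ->
  (forall m, supp_rate d1 m (supp_price pi m) - supp_rate d2 m (supp_price pi m) <= f m) ->
  (forall m, addon_rate d1 pi m - addon_rate d2 pi m <= g m) ->
  revenue d1 pi - revenue d2 pi <= max_price X *
    ((1 + M%:R) * \sum_n e n + \sum_m f m +
     (\sum_(n < N) core_rate d2 n (core_price pi n)) * \sum_m g m).
Proof.
move=> h1 h2 hv e0 f0 g0 he hf hg; rewrite !revenueE.
have c := sum_rate_diff (fun n => core_price_bounds hp (core_price pi n)) e0 he.
have s := sum_rate_diff (fun m => supp_price_bounds hp (supp_price pi m)) f0 hf.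
have a := sum_rate_diff (fun m => addon_price_bounds m hp hv) g0 hg.
have /andP[A0 AM] := sum_rate_price_bounds
  (fun m => addon_rate_in_unit pi m h1) (fun m => addon_price_bounds m hp hv).
rewrite card_ord in AM.
set A1 := \sum_(m < M) addon_rate d1 pi m * _ in a A0 AM *.
set A2 := \sum_(m < M) addon_rate d2 pi m * _ in a *.
set G1 := \sum_(n < N) core_rate d1 n (core_price pi n).
set G2 := \sum_(n < N) core_rate d2 n (core_price pi n).
have G20 : 0 <= G2.
  by apply: sumr_ge0 => n _; case: h2 => /(_ n (core_price pi n))/andP[].
have GE : G1 - G2 <= \sum_n e n by rewrite -sumrB; apply: ler_sum.
have E0 : 0 <= \sum_n e n by apply: sumr_ge0.
have t1 : (G1 - G2) * A1 <= \sum_n e n * (M%:R * max_price X).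
  rewrite -mulr_suml; apply: le_trans (ler_wpM2l E0 AM).
  exact: ler_wpM2r.
have t2 := ler_wpM2l G20 a.
rewrite -mulr_suml in t1; move: c s t1 t2.
by move: (\sum_n e n) (\sum_m f m) (\sum_m g m) => E F G; lra.
Qed.

Lemma revenue_bounds (d : demand X) (pi : policy X) : demand_in_unit d ->
  discounts_valid pi ->
  0 <= revenue d pi <= (N%:R + M%:R + N%:R * M%:R) * max_price X.
Proof.
move=> hd hv; have [h1 h2 _ _] := hd; rewrite revenueE.
have /andP[c0 cP] := sum_rate_price_bounds
  (fun n => h1 n (core_price pi n)) (fun n => core_price_bounds hp (core_price pi n)).
have /andP[s0 sP] := sum_rate_price_bounds
  (fun m => h2 m (supp_price pi m)) (fun m => supp_price_bounds hp (supp_price pi m)).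
have /andP[a0 aP] := sum_rate_price_bounds
  (fun m => addon_rate_in_unit pi m hd) (fun m => addon_price_bounds m hp hv).
have g0 : 0 <= \sum_(n < N) core_rate d n (core_price pi n).
  by apply: sumr_ge0 => n _; case/andP: (h1 n (core_price pi n)).
have gN : \sum_(n < N) core_rate d n (core_price pi n) <= N%:R.
  apply: (le_trans (ler_sum _ (fun n _ => proj2 (andP (h1 n (core_price pi n)))))).
  by rewrite sumr_const card_ord.
have t := ler_pM g0 a0 gN aP; rewrite !card_ord in cP sP t.
rewrite !addr_ge0 ?mulr_ge0 //=; apply: le_trans (lerD (lerD cP sP) t) _.
by rewrite !mulrDl mulrA.
Qed.

End Decomposition.

(** * The regret bound *)

Lemma ler_sum_single (R : realType) (I : finType) (F : I -> R) (i : I) :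
  (forall j, 0 <= F j) -> F i <= \sum_j F j.
Proof. by move=> F0; rewrite (bigD1 i) //= lerDl sumr_ge0. Qed.

Lemma sum_eq_op (I : finType) (i : I) : (\sum_j (i == j))%N = 1%N.
Proof.
rewrite (bigD1 i) //= eqxx big1 // => j; rewrite eq_sym.
by move=> /negPf ->.
Qed.

Section RegretBound.
Context {R : realType} {X : problem R}.
Local Notation N := (ncore X).
Local Notation M := (nsupp X).
Variables (d : demand X) (eps : R) (run : @learner R X) (T : nat).
Hypotheses (hp : nonneg_prices X) (hd : demand_in_unit d).
Hypotheses (hrun : ucb_add_on eps run) (eps0 : 0 < eps).
Hypotheses (N0 : (0 < N)%N) (M0 : (0 < M)%N) (T2 : (2 <= T)%N).
Hypothesis ex_feasible : exists pi : policy X, feasible pi.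
Implicit Types (h : seq (outcome X)) (pi : policy X).

Local Notation P := (max_price X).
Local Notation U := ((largest_set X)%:R : R).
Local Notation l := (ln T%:R : R).
Local Notation failR q a h := ((fail run q a h)%:R : R).
Local Notation gapR a h := (exposure d run a h * bonus l (cnt run a h)).

Let N1 : 1 <= N%:R :> R. Proof. by rewrite ler1n. Qed.
Let M1 : 1 <= M%:R :> R. Proof. by rewrite ler1n. Qed.
Let l0 : 0 <= l. Proof. by apply: ln_ge0; rewrite ler1n ltnW. Qed.

Definition estimate h : demand X :=
  ucb_demand (size (epoch run h)).+1 (log_of run (epoch run h)).

Lemma estimate_in_unit h : demand_in_unit (estimate h).
Proof. by split => *; exact: ucb_in_unit. Qed.

Lemma addon_rate_estimate pi m h :
  addon_rate (estimate h) pi m = arm_ucb run (addon_arm pi m) h.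
Proof. by rewrite /addon_rate /addon_arm; case: ifP. Qed.

(** Summed over all prices, so that one quantity serves both the optimal policy and the policy in
    use, and its expectation can be taken arm by arm. *)
Definition core_fails h (n : 'I_N) : R :=
  \sum_p failR (core_rate d n p) (core_arm n p) h.
Definition supp_fails h (m : 'I_M) : R :=
  \sum_p failR (supp_rate d m p) (supp_arm m p) h.
Definition addon_fails h (m : 'I_M) : R :=
  \sum_p failR (orig_rate d m p) (orig_arm m p) h +
  \sum_p failR (disc_rate d m p) (disc_arm m p) h.
(** Prices not in use have exposure 0, so the sum over all prices is the single term of the price in
    use. *)
Definition core_gaps h (n : 'I_N) : R := \sum_p gapR (core_arm n p) h.
Definition supp_gaps h (m : 'I_M) : R := \sum_p gapR (supp_arm m p) h.
Definition addon_gaps h (m : 'I_M) : R :=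
  \sum_p gapR (orig_arm m p) h + \sum_p gapR (disc_arm m p) h.

(** The weights are those of [revenue_diff], with the core demand in front of the add-on errors
    bounded by [N]. In [gaps] that demand is already contained in the exposure. *)
Definition fails h : R := (1 + M%:R) * (\sum_n core_fails h n) +
  \sum_m supp_fails h m + N%:R * \sum_m addon_fails h m.
Definition gaps h : R := (1 + M%:R) * (\sum_n core_gaps h n) +
  \sum_m supp_gaps h m + \sum_m addon_gaps h m.

Let gap_ge0 a h : 0 <= gapR a h.
Proof. by rewrite mulr_ge0 ?exposure_ge0 ?bonus_ge0. Qed.

Lemma core_fails_ge0 h n : 0 <= core_fails h n.
Proof. by apply: sumr_ge0 => p _; exact: ler0n. Qed.
Lemma supp_fails_ge0 h m : 0 <= supp_fails h m.
Proof. by apply: sumr_ge0 => p _; exact: ler0n. Qed.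
Lemma addon_fails_ge0 h m : 0 <= addon_fails h m.
Proof. by apply: addr_ge0; apply: sumr_ge0 => p _; exact: ler0n. Qed.
Lemma core_gaps_ge0 h n : 0 <= core_gaps h n. Proof. exact: sumr_ge0. Qed.
Lemma supp_gaps_ge0 h m : 0 <= supp_gaps h m. Proof. exact: sumr_ge0. Qed.

Lemma core_fail_le h n p : failR (core_rate d n p) (core_arm n p) h <= core_fails h n.
Proof. exact: (ler_sum_single (F := fun p => failR (core_rate d n p) (core_arm n p) h)). Qed.

Lemma supp_fail_le h m p : failR (supp_rate d m p) (supp_arm m p) h <= supp_fails h m.
Proof. exact: (ler_sum_single (F := fun p => failR (supp_rate d m p) (supp_arm m p) h)). Qed.

Lemma addon_fail_le h pi m :
  failR (addon_rate d pi m) (addon_arm pi m) h <= addon_fails h m.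
Proof.
rewrite /addon_rate /addon_arm /addon_fails; case: ifP => _.
  rewrite addrC -[leLHS]addr0; apply: lerD; last by apply: sumr_ge0.
  exact: (ler_sum_single (F := fun p => failR (disc_rate d m p) (disc_arm m p) h)).
rewrite -[leLHS]addr0; apply: lerD; last by apply: sumr_ge0.
exact: (ler_sum_single (F := fun p => failR (orig_rate d m p) (orig_arm m p) h)).
Qed.

Lemma core_rate_sum_bounds d' pi : demand_in_unit d' ->
  0 <= \sum_(n < N) core_rate d' n (core_price pi n) <= N%:R.
Proof.
case=> h _ _ _; apply/andP; split.
  by apply: sumr_ge0 => n _; case/andP: (h n (core_price pi n)).
apply: (le_trans (ler_sum _ (fun n _ => proj2 (andP (h n (core_price pi n)))))).
by rewrite sumr_const card_ord.
Qed.

Lemma optimism h pi : discounts_valid pi ->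
  revenue d pi - revenue (estimate h) pi <= P * fails h.
Proof.
move=> hv; have hq := hd; case: hq => q1 q2 q3 q4.
have := @revenue_diff R X hp d (estimate h) pi (core_fails h) (supp_fails h)
  (addon_fails h) hd (estimate_in_unit h) hv (core_fails_ge0 h)
  (supp_fails_ge0 h) (addon_fails_ge0 h).
move=> /(_ _ _ _)/le_trans; apply.
- by move=> n; apply: le_trans (core_fail_le h n (core_price pi n));
  exact: (arm_ucb_ge hrun N0 (core_arm n _) h (q1 n _)).
- by move=> m; apply: le_trans (supp_fail_le h m (supp_price pi m));
  exact: (arm_ucb_ge hrun N0 (supp_arm m _) h (q2 m _)).
- move=> m; apply: le_trans (addon_fail_le h pi m).
  rewrite addon_rate_estimate; apply: (arm_ucb_ge hrun N0).
  exact: addon_rate_in_unit.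
rewrite ler_wpM2l ?max_price_ge0 // /fails lerD2l ler_wpM2r //.
  by apply: sumr_ge0 => m _; exact: addon_fails_ge0.
by case/andP: (core_rate_sum_bounds pi (estimate_in_unit h)).
Qed.

Lemma exposure_core h n : exposure d run (core_arm n (core_price (run h) n)) h = 1.
Proof. by rewrite /exposure /= eqxx mul1r expect_cst. Qed.

Lemma exposure_supp h m : exposure d run (supp_arm m (supp_price (run h) m)) h = 1.
Proof. by rewrite /exposure /= eqxx mul1r expect_cst. Qed.

Lemma exposure_addon h m : exposure d run (addon_arm (run h) m) h =
  \sum_(n < N) core_rate d n (core_price (run h) n).
Proof.
by rewrite /exposure /addon_arm; case: ifP => ms /=; rewrite ms eqxx mul1r
  expect_core_purchases.
Qed.

(** [revenue_diff] is applied with the true demand as [d2]: the add-on bonuses are multiplied by the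
    true core demand rate, which by [exposure_addon] is the exposure of the arms in use. *)
Lemma overestimation h : (size h < T)%N -> discounts_valid (run h) ->
  revenue (estimate h) (run h) - revenue d (run h) <= P * (fails h + gaps h).
Proof.
move=> hT hv; have hq := hd; case: hq => q1 q2 q3 q4.
pose b a : R := bonus l (cnt run a h).
have b0 a : 0 <= b a by exact: bonus_ge0.
have := @revenue_diff R X hp (estimate h) d (run h)
  (fun n => core_fails h n + core_gaps h n)
  (fun m => supp_fails h m + supp_gaps h m)
  (fun m => addon_fails h m + b (addon_arm (run h) m))
  (estimate_in_unit h) hd hv
  (fun n => addr_ge0 (core_fails_ge0 h n) (core_gaps_ge0 h n))
  (fun m => addr_ge0 (supp_fails_ge0 h m) (supp_gaps_ge0 h m))
  (fun m => addr_ge0 (addon_fails_ge0 h m) (b0 _)).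
move=> /(_ _ _ _)/le_trans; apply.
- move=> n; set p := core_price (run h) n.
  have bnd : core_rate (estimate h) n p - core_rate d n p <=
      failR (core_rate d n p) (core_arm n p) h + b (core_arm n p) :=
    arm_ucb_le hrun N0 (q1 n p) hT (core_undoubled hrun N0 (h:=h) (n:=n)).
  apply: le_trans bnd _; apply: lerD; first exact: core_fail_le.
  rewrite -[leLHS]mul1r -(exposure_core h n).
  exact: (ler_sum_single (F := fun p => gapR (core_arm n p) h)).
- move=> m; set p := supp_price (run h) m.
  have bnd : supp_rate (estimate h) m p - supp_rate d m p <=
      failR (supp_rate d m p) (supp_arm m p) h + b (supp_arm m p) :=
    arm_ucb_le hrun N0 (q2 m p) hT (supp_undoubled hrun N0 (h:=h) (m:=m)).
  apply: le_trans bnd _; apply: lerD; first exact: supp_fail_le.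
  rewrite -[leLHS]mul1r -(exposure_supp h m).
  exact: (ler_sum_single (F := fun p => gapR (supp_arm m p) h)).
- move=> m; rewrite addon_rate_estimate.
  apply: (le_trans (arm_ucb_le hrun N0 (addon_rate_in_unit (run h) m hd) hT
    (addon_undoubled hrun N0 (h:=h) (m:=m)))).
  by apply: lerD => //; exact: addon_fail_le.
rewrite ler_wpM2l ?max_price_ge0 //.
have /andP[G0 GN] := core_rate_sum_bounds (run h) hd.
have gap_addon : (\sum_(n < N) core_rate d n (core_price (run h) n)) *
    \sum_m b (addon_arm (run h) m) <= \sum_m addon_gaps h m.
  rewrite mulr_sumr; apply: ler_sum => m _; rewrite -(exposure_addon h m).
  rewrite /addon_gaps /addon_arm; case: ifP => _.
    rewrite addrC -[leLHS]addr0; apply: lerD; last by apply: sumr_ge0.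
    exact: (ler_sum_single (F := fun p => gapR (disc_arm m p) h)).
  rewrite -[leLHS]addr0; apply: lerD; last by apply: sumr_ge0.
  exact: (ler_sum_single (F := fun p => gapR (orig_arm m p) h)).
have fail_addon : (\sum_(n < N) core_rate d n (core_price (run h) n)) *
    \sum_m addon_fails h m <= N%:R * \sum_m addon_fails h m.
  by rewrite ler_wpM2r // sumr_ge0 // => m _; exact: addon_fails_ge0.
rewrite /fails /gaps; move: gap_addon fail_addon.
move: (core_fails h) (core_gaps h) (supp_fails h) (supp_gaps h) (addon_fails h)
  (addon_gaps h) => cf cg sf sg af ag; rewrite !big_split /=.
move: (\sum_n cf _) (\sum_n cg _) (\sum_m sf _) (\sum_m sg _) (\sum_m af _)
  (\sum_m ag _) (\sum_m b _) (\sum_(n < N) _) => *; lra.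
Qed.

(** The grid dates from the first period of the episode, which is at least half of [(size h).+2] by
    the doubling rule. *)
Lemma inv_grid_size h :
  (0 < grid_size eps (size (epoch run h)).+1)%N /\
  (grid_size eps (size (epoch run h)).+1)%:R^-1 <=
    2 * eps * (Num.sqrt (size h).+2%:R)^-1.
Proof.
set s := (size (epoch run h)).+1.
have t0 : 0 < Num.sqrt (size h).+2%:R :> R by rewrite sqrtr_gt0 ltr0n.
have ss : Num.sqrt (size h).+2%:R <= 2 * Num.sqrt s%:R :> R.
  have e2 : 2 = Num.sqrt 4 :> R.
    by rewrite (_ : 4 = 2 ^+ 2 :> R) ?sqrtr_sqr ?ger0_norm //; ring.
  rewrite [X in _ <= X * _]e2 -sqrtrM // ler_wsqrtr // -natrM ler_nat /s.
  have := episode_start_half hrun N0 h; rewrite -size_epoch; lia.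
have q0 : 0 < Num.sqrt s%:R / eps by rewrite divr_gt0 // sqrtr_gt0 ltr0n.
have Kge : Num.sqrt s%:R / eps <= (grid_size eps s)%:R.
  rewrite /grid_size natr_absz ger0_norm; first exact: ceil_ge.
  by rewrite ceil_ge0 (lt_trans _ q0) // ltrN10.
have K0 : 0 < (grid_size eps s)%:R :> R by exact: lt_le_trans Kge.
split; first by move: K0; rewrite ltr0n.
apply: (le_trans (y := (Num.sqrt s%:R / eps)^-1)); first by rewrite lef_pV2.
rewrite invf_div ler_pdivrMr ?sqrtr_gt0 ?ltr0n // mulrAC ler_pdivlMr //.
by have := ler_wpM2l (ltW eps0) ss; lra.
Qed.

(** Three comparisons: optimism at a feasible policy, near-optimality of the policy in use under the
    estimate, and overestimation at the policy in use. The outer two each contribute [fails]. *)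
Lemma step_regret h : (size h < T)%N ->
  opt_revenue d - revenue d (run h) <=
  4 * eps * (N%:R * M%:R * P) * (Num.sqrt (size h).+2%:R)^-1 +
  P * (2 * fails h + gaps h).
Proof.
move=> hT.
have out := episode_policy_output hrun (leqnn (size h)).
rewrite /= -/(epoch run h) -(run_epoch hrun) in out.
have hv := ddp_output_discounts_valid out.
have [K0 Kinv] := inv_grid_size h.
have over := overestimation hT hv.
have Q0 : 0 <= N%:R * M%:R * P by rewrite !mulr_ge0 ?ler0n ?max_price_ge0.
have disc := ler_wpM2l Q0 Kinv.
set B := leRHS.
suff best pi : feasible pi -> revenue d pi <= revenue d (run h) + B.
  rewrite lerBlDl; apply: bigmax_le => [|pi]; last exact: best.
  (* The default value 0 of the maximum lies below the revenue of any feasible policy. *)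
  case: ex_feasible => pi fpi; apply: le_trans (best pi fpi).
  by case/andP: (revenue_bounds hp hd (feasible_discounts_valid fpi)).
move=> fpi; have under := optimism h (feasible_discounts_valid fpi).
have := ddp_output_near_optimal hp (estimate_in_unit h) K0 out fpi.
by move: disc over under; rewrite /B; lra.
Qed.

Let Q0 : 0 <= N%:R * M%:R * P.
Proof. by rewrite !mulr_ge0 ?ler0n ?max_price_ge0. Qed.

Lemma step_regret_trivial h :
  opt_revenue d - revenue d (run h) <= 3 * (N%:R * M%:R * P).
Proof.
have hv : discounts_valid (run h).
  rewrite (run_epoch hrun).
  exact: ddp_output_discounts_valid (episode_policy_output hrun (leqnn (size h))).
have /andP[r0 _] := revenue_bounds hp hd hv.
suff : opt_revenue d <= 3 * (N%:R * M%:R * P) by lra.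
apply: bigmax_le => [|pi fpi]; first by rewrite mulr_ge0.
have /andP[_ r1] := revenue_bounds hp hd (feasible_discounts_valid fpi).
apply: le_trans r1 _; rewrite [leRHS]mulrA ler_wpM2r ?max_price_ge0 //.
by move: (N%:R : R) (M%:R : R) N1 M1 => x y x1 y1; nra.
Qed.

Lemma regret_trivial : regret d run T <= 3 * (N%:R * M%:R * P) * T%:R.
Proof.
rewrite regretE.
apply: (le_trans (y := \sum_(i < T) 3 * (N%:R * M%:R * P))).
  apply: ler_sum => i _; rewrite -[leRHS](hexpect_cst d run i).
  by apply: le_hexpect => // h _; exact: step_regret_trivial.
by rewrite sumr_const card_ord -[leLHS]mulr_natr.
Qed.

Lemma card_core_prices : #|{: core_prices X}|%:R <= U.
Proof. by rewrite ler_nat -cardfE leq_max leqnn. Qed.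
Lemma card_supp_prices : #|{: supp_prices X}|%:R <= U.
Proof. by rewrite ler_nat -cardfE !leq_max leqnn orbT. Qed.
Lemma card_addon_prices : #|{: addon_prices X}|%:R <= U.
Proof. by rewrite ler_nat -cardfE !leq_max leqnn !orbT. Qed.

Lemma U_ge1 : 1 <= U.
Proof.
case: ex_feasible => pi _; rewrite ler1n.
apply: leq_trans (leq_maxl _ _); rewrite cardfE; apply/card_gt0P.
by exists (core_price pi (Ordinal N0)).
Qed.

Lemma hexpect_family_fails (I : finType) (A : I -> arm) (q : I -> R) B i :
  (forall p, sound d (q p) B (A p)) -> #|I|%:R <= U ->
  hexpect d run i (fun h => \sum_p failR (q p) (A p) h) <= U * (8 / i.+2%:R).
Proof.
move=> hA cI; rewrite hexpect_sum.
apply: (le_trans (y := \sum_(p : I) (8 / i.+2%:R))).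
  by apply: ler_sum => p _; exact: (hexpect_fail _ hd i (hA p)).
rewrite sumr_const -[leLHS]mulr_natl ler_wpM2r //.
by rewrite divr_ge0 ?ler0n.
Qed.

(** The weighted number of families is (1 + M) N + M + 2 N M <= 5 N M, and 40 = 5 * 8. *)
Lemma hexpect_fails i :
  hexpect d run i fails <= 40 * (N%:R * M%:R * U) / i.+2%:R.
Proof.
rewrite /fails !hexpectD !hexpectZ !hexpect_sum.
set u := U * (8 / i.+2%:R).
have u0 : 0 <= u by rewrite mulr_ge0 ?divr_ge0 ?ler0n.
have c : \sum_(n < N) hexpect d run i (fun h => core_fails h n) <= N%:R * u.
  apply: (le_trans (ler_sum _ (fun n _ => hexpect_family_fails i
    (fun p => core_arm_sound n p hd) card_core_prices))).
  by rewrite sumr_const card_ord -[leLHS]mulr_natl.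
have s : \sum_(m < M) hexpect d run i (fun h => supp_fails h m) <= M%:R * u.
  apply: (le_trans (ler_sum _ (fun m _ => hexpect_family_fails i
    (fun p => supp_arm_sound m p hd) card_supp_prices))).
  by rewrite sumr_const card_ord -[leLHS]mulr_natl.
have a : \sum_(m < M) hexpect d run i (fun h => addon_fails h m) <= M%:R * (2 * u).
  apply: (le_trans (y := \sum_(m < M) (2 * u))); last first.
    by rewrite sumr_const card_ord -[leLHS]mulr_natl.
  apply: ler_sum => m _; rewrite /addon_fails hexpectD [2 * u]mulr_natl mulr2n.
  apply: lerD.
    exact: (hexpect_family_fails i (fun p => orig_arm_sound m p hd) card_supp_prices).
  exact: (hexpect_family_fails i (fun p => disc_arm_sound m p hd) card_addon_prices).
have -> : 40 * (N%:R * M%:R * U) / i.+2%:R = 5 * (N%:R * M%:R) * u.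
  by rewrite /u; move: (i.+2%:R^-1) => z; ring.
clearbody u; move: c s a; move: (\sum_(n < N) _) (\sum_(m < M) _) (\sum_(m < M) _) => C S A c s a.
have Nge0 : 0 <= N%:R :> R by exact: ler0n.
have Mge0 : 0 <= M%:R :> R by exact: ler0n.
have M1ge0 : 0 <= 1 + M%:R :> R by lra.
apply: le_trans (lerD (lerD (ler_wpM2l M1ge0 c) s) (ler_wpM2l Nge0 a)) _.
rewrite -subr_ge0.
move: N1 M1; move: (N%:R : R) (M%:R : R) Nge0 Mge0 => x y x0 y0 x1 y1.
have h1 : 0 <= (x * u) * (y - 1) by rewrite !mulr_ge0 ?subr_ge0.
have h2 : 0 <= (y * u) * (x - 1) by rewrite !mulr_ge0 ?subr_ge0.
by lra.
Qed.

(** The batch bound [N] of the add-on arms enters one term linearly and the other under a square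
    root; both are bounded by a factor [N], which the prefactor N M absorbs. As for the failures,
    the families add up to at most 5 N M times [w]. *)
Lemma sum_hexpect_gaps :
  \sum_(i < T) hexpect d run i gaps <=
  N%:R * M%:R * (10 * U + 50 * Num.sqrt (U * T%:R * l)).
Proof.
set Z := Num.sqrt (U * T%:R * l).
pose w := 2 * U + 10 * Z.
have Z0 : 0 <= Z by exact: sqrtr_ge0.
have w0 : 0 <= w by rewrite addr_ge0 ?mulr_ge0 ?ler0n.
have famZ (B : nat) : (0 < B)%N ->
    2 * B%:R * U + 10 * Num.sqrt l * Num.sqrt (U * (B * T)%:R) <= B%:R * w.
  move=> B0; have B1 : 1 <= B%:R :> R by rewrite ler1n.
  have sB : Num.sqrt l * Num.sqrt (U * (B * T)%:R) <= B%:R * Z.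
    rewrite -sqrtrM // -[B%:R in leRHS]ger0_norm ?ler0n // -sqrtr_sqr -sqrtrM ?sqr_ge0 //.
    rewrite ler_wsqrtr // natrM.
    have -> : l * (U * (B%:R * T%:R)) = B%:R * (U * T%:R * l) by ring.
    rewrite ler_wpM2r ?mulr_ge0 ?ler0n //.
    by rewrite expr2 ler_peMl ?ler0n.
  by rewrite /w; lra.
have c (n : 'I_N) : \sum_(i < T) hexpect d run i (fun h => core_gaps h n) <= w.
  rewrite -[leRHS]mul1r; apply: le_trans (famZ 1%N isT).
  apply: (family_bonus _ hd _ (fun p => core_arm_sound n p hd) _ card_core_prices) => //.
  by move=> pi; rewrite /= sum_eq_op.
have s (m : 'I_M) : \sum_(i < T) hexpect d run i (fun h => supp_gaps h m) <= w.
  rewrite -[leRHS]mul1r; apply: le_trans (famZ 1%N isT).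
  apply: (family_bonus _ hd _ (fun p => supp_arm_sound m p hd) _ card_supp_prices) => //.
  by move=> pi; rewrite /= sum_eq_op.
have a (m : 'I_M) : \sum_(i < T) hexpect d run i (fun h => addon_gaps h m) <=
    N%:R * w + N%:R * w.
  under eq_bigr do rewrite /addon_gaps hexpectD.
  rewrite big_split; apply: lerD; apply: le_trans (famZ N N0).
    apply: (family_bonus _ hd _ (fun p => orig_arm_sound m p hd) _ card_supp_prices) => //.
    move=> pi /=; rewrite -[X in (_ <= X)%N](sum_eq_op (supp_price pi m)).
    by apply: leq_sum => p _; case: (_ \notin _).
  apply: (family_bonus _ hd _ (fun p => disc_arm_sound m p hd) _ card_addon_prices) => //.
  move=> pi /=; rewrite -[X in (_ <= X)%N](sum_eq_op (disc_price pi m)).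
  by apply: leq_sum => p _; case: (_ \in _).
have -> : \sum_(i < T) hexpect d run i gaps =
    (1 + M%:R) * (\sum_(n < N) \sum_(i < T) hexpect d run i (fun h => core_gaps h n)) +
    \sum_(m < M) \sum_(i < T) hexpect d run i (fun h => supp_gaps h m) +
    \sum_(m < M) \sum_(i < T) hexpect d run i (fun h => addon_gaps h m).
  rewrite exchange_big [X in _ = _ + X + _]exchange_big [X in _ = _ + X]exchange_big.
  rewrite mulr_sumr -!big_split; apply: eq_bigr => i _ /=.
  by rewrite /gaps !hexpectD hexpectZ !hexpect_sum.
have sum_le (k : nat) (F : 'I_k -> R) (z : R) : (forall j, F j <= z) ->
    \sum_j F j <= k%:R * z.
  move=> Fz; apply: (le_trans (y := \sum_(j < k) z)); first exact: ler_sum.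
  by rewrite sumr_const card_ord -[leLHS]mulr_natl.
have c' := sum_le _ _ _ c; have s' := sum_le _ _ _ s; have a' := sum_le _ _ _ a.
have Mge0 : 0 <= 1 + M%:R :> R by have ? := M1; lra.
apply: le_trans (lerD (lerD (ler_wpM2l Mge0 c') s') a') _.
have -> : 10 * U + 50 * Z = 5 * w by rewrite /w; ring.
clearbody w; move: N1 M1; move: (N%:R : R) (M%:R : R) => x y x1 y1.
have h1 : 0 <= (x * w) * (y - 1) by rewrite !mulr_ge0 ?subr_ge0 //; lra.
have h2 : 0 <= (y * w) * (x - 1) by rewrite !mulr_ge0 ?subr_ge0 //; lra.
by lra.
Qed.

Lemma regret_main : regret d run T <=
  N%:R * M%:R * P * (8 * eps * Num.sqrt T%:R + 160 * (U * l) + 10 * U +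
    50 * Num.sqrt (U * T%:R * l)).
Proof.
rewrite regretE.
set Z := Num.sqrt (U * T%:R * l).
have P0 : 0 <= P by exact: max_price_ge0.
apply: (le_trans (y := \sum_(i < T)
    (4 * eps * (N%:R * M%:R * P) * (Num.sqrt i.+2%:R)^-1 +
     P * (2 * (40 * (N%:R * M%:R * U) / i.+2%:R) + hexpect d run i gaps)))).
  apply: ler_sum => i _.
  apply: (le_trans (y := hexpect d run i (fun h =>
      4 * eps * (N%:R * M%:R * P) * (Num.sqrt i.+2%:R)^-1 +
      P * (2 * fails h + gaps h)))).
    apply: le_hexpect => // h hi; rewrite -hi; apply: step_regret.
    by rewrite hi ltn_ord.
  rewrite hexpectD hexpect_cst lerD2l hexpectZ hexpectD hexpectZ.
  by rewrite ler_wpM2l // lerD2r ler_wpM2l // hexpect_fails.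
rewrite big_split /= -mulr_sumr -mulr_sumr big_split /= -mulr_sumr -mulr_sumr.
have e1 := sum_inv_sqrt_le (R := R) T.
(* For T >= 2, T + 1 <= T^2, so ln (T + 1) <= 2 ln T. *)
have e2 : \sum_(i < T) i.+2%:R^-1 <= 2 * l :> R.
  apply: le_trans (sum_inv_le_ln T) _.
  have T0 : 0 < T%:R :> R by rewrite ltr0n; lia.
  rewrite mulr_natl -lnXn // ler_ln ?posrE ?ltr0n ?exprn_gt0 //.
  rewrite -natrX ler_nat; nia.
have e3 := sum_hexpect_gaps; rewrite -/Z in e3.
have U0 : 0 <= U by exact: ler0n.
have NMU0 : 0 <= 40 * (N%:R * M%:R * U) by rewrite !mulr_ge0 ?ler0n.
have eQ : 0 <= 4 * eps * (N%:R * M%:R * P) by rewrite mulr_ge0 // mulr_ge0 // ltW.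
have t1 := ler_wpM2l eQ e1; have t2 := ler_wpM2l NMU0 e2.
have t3 := ler_wpM2l P0 (lerD (ler_wpM2l (ler0n R 2) t2) e3).
apply: le_trans (lerD t1 t3) _.
rewrite le_eqVlt; apply/orP; left; apply/eqP; ring.
Qed.

End RegretBound.

Theorem theorem2 (R : realType) :
  exists C : R, 0 < C /\
  forall (X : problem R) (d : demand X) (eps : R) (run : learner X) (T : nat),
    (0 < ncore X)%N -> (0 < nsupp X)%N -> nonneg_prices X ->
    (exists pi : policy X, feasible pi) ->
    demand_in_unit d -> 0 < lambda d ->
    0 < eps -> ucb_add_on eps run -> (2 <= T)%N ->
    regret d run T <=
      C * ((ncore X)%:R * (nsupp X)%:R * max_price X *
           (1 / lambda d * Num.sqrt ((largest_set X)%:R * T%:R * ln T%:R)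
            + eps * Num.sqrt T%:R)).
Proof.
(* 230 = 160 + 20 + 50: for T > U ln T, the terms 160 U ln T, 10 U and 50 Z of [regret_main] are at
   most 160 Z, 20 Z and 50 Z. *)
exists 230; split=> // X d eps run T N0 M0 hp exf hd lam0 eps0 hrun T2.
have main := regret_main hp hd hrun eps0 N0 M0 T2 exf.
have triv := regret_trivial T hp hd hrun N0 M0.
have U1 := U_ge1 N0 exf.
have Q0 : 0 <= (ncore X)%:R * (nsupp X)%:R * max_price X :> R.
  by rewrite !mulr_ge0 ?ler0n ?max_price_ge0.
(* [lambda] is a minimum that starts from the default value 1. *)
have lam1 : 1 <= 1 / lambda d.
  by rewrite ler_pdivlMr // mul1r /lambda; exact: bigmin_le_id.
have l12 : 1 / 2 <= ln T%:R :> R.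
  apply: le_trans (ln2_ge) _.
  by rewrite ler_ln ?posrE ?ltr0n ?(ltnW T2) // ler_nat.
have sT0 : 0 <= Num.sqrt T%:R :> R by exact: sqrtr_ge0.
set U : R := (largest_set X)%:R in U1 main *.
set Z := Num.sqrt (U * T%:R * ln T%:R) in main *.
have Z0 : 0 <= Z by exact: sqrtr_ge0.
set Q := _ * _ * max_price X in Q0 main triv *.
have T0 : 0 <= T%:R :> R by exact: ler0n.
have ZlamZ : Z <= 1 / lambda d * Z by rewrite ler_peMl.
suff : regret d run T <= Q * (230 * Z + 8 * eps * Num.sqrt T%:R).
  move/le_trans; apply; rewrite [leRHS]mulrCA ler_wpM2l //.
  have e0 : 0 <= eps * Num.sqrt T%:R by rewrite mulr_ge0 // ltW.
  by move: ZlamZ e0; lra.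
(* Z^2 is the product of T and U ln T, so the smaller of the two is at most Z: either the trivial
   bound suffices, or the lower-order terms of [regret_main] are dominated. *)
have [TU|UT] := leP (T%:R : R) (U * ln T%:R).
  have TZ : T%:R <= Z.
    rewrite -[leLHS]ger0_norm // -sqrtr_sqr ler_wsqrtr //.
    by rewrite expr2 mulrAC ler_wpM2r.
  apply: le_trans triv _; rewrite (_ : 3 * Q * T%:R = Q * (3 * T%:R)); last by ring.
  rewrite ler_wpM2l //.
  have e0 : 0 <= eps * Num.sqrt T%:R by rewrite mulr_ge0 // ltW.
  by move: TZ e0; lra.
have UlZ : U * ln T%:R <= Z.
  have Ul0 : 0 <= U * ln T%:R by apply: mulr_ge0; lra.
  rewrite -[leLHS]ger0_norm // -sqrtr_sqr ler_wsqrtr //.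
  by rewrite expr2 [leRHS]mulrAC ler_wpM2l // ltW.
have U2Z : U <= 2 * Z.
  have : U * (1 / 2) <= U * ln T%:R by rewrite ler_wpM2l //; lra.
  by lra.
apply: le_trans main _; rewrite ler_wpM2l //; lra.
Qed.
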